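(* Let $G$ be a complex Banach space, $R$ a possibly unbounded scalar type spectral operator in $G$ with resolution of the identity $E$ and spectrum $\sigma(R)$. Let $K\subseteq\mathbb{R}$ be a compact nondegenerate interval, and let $U\subseteq\mathbb{C}$ be an open neighbourhood of $\sigma(R)$ such that $K\cdot U\subseteq U$. Let $X$ be a compact space, $\mathfrak{g}:X\times K\to\mathfrak{L}_E^\infty(U)$ a continuous map, $\{x_n\}_{n\in\mathbb{N}}$ a sequence in $X$, $t_0\in K$, and $\{f^n\}_{n\in\mathbb{N}}$ a sequence of analytic maps $f^n:U\to\mathbb{C}$ such that: (i) $\sup_{t\in K}\|\widetilde{f^n_t}\|_\infty^E<\infty$ for every $n\in\mathbb{N}$; (ii) for every $v\in\mathrm{Dom}(R)$ the limit $\lim_{n\to\infty}f^n(t_0R)v$ exists in $G$; (iii) for every $n\in\mathbb{N}$ and $t\in K$, $$\mathfrak{g}(x_n,t)=\widetilde{\left(\frac{df^n}{d\lambda}\right)_t}.$$ Then there exist $y\in X$ and a subsequence $\{x_{n_k}\}_{k\in\mathbb{N}}$ of $\{x_n\}_{n\in\mathbb{N}}$ converging to $y$ such that for every open neighbourhood $W$ of $t_0$ in $\mathbb{R}$ with $W\subset K$ there exists a map $h\in\mathcal{C}^1(W,\widehat{F})$ whose derivative satisfies, for every $t\in W$, $$(\mathrm{D}h)(t)=\mathfrak{i}_F\bigl(\mathfrak{g}(y,t)(R)R\bigr),$$ and $$h=\lim_{k\to\infty}\bigl(W\ni t\mapsto(\mathfrak{i}_F\circ j_{B(G)}^F)(f^{n_k}(tR))\bigr)\quad\text{in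 }\mathcal{C}_u(W,\widehat{F}).$$
   Context: Scalar type operators and functional calculus (Dunford–Schwartz). $B(G)$ is the Banach space of bounded linear operators on $G$ with the operator norm, $\mathbf{1}$ its identity; $\mathcal{B}(\mathbb{C})$ is the set of Borel subsets of $\mathbb{C}$. A possibly unbounded operator $R$ in $G$ is scalar type with resolution of the identity $E$ if $E:\mathcal{B}(\mathbb{C})\to B(G)$ is a projection-valued spectral measure, countably additive in the strong operator topology, with $E(\mathbb{C})=\mathbf{1}$ and $E(\delta_1\cap\delta_2)=E(\delta_1)E(\delta_2)$, and $R=\int\lambda\,dE(\lambda)$, meaning $\mathrm{Dom}(R)=\{v\in G: \lim_n\int_{|\lambda|\le n}\lambda\,dE(\lambda)v \text{ exists}\}$ and $Rv$ is this limit. One has $E(\sigma(R))=\mathbf{1}$. For a Borel function $p$ defined on a Borel set $U\supseteq\sigma(R)$ (or a function on $\mathbb{C}$ whose restriction to $U$ is Borel), $p(R)$ is the Borel functional calculus, $p(R)=\int_U p\,dE$, with $p(R)v=\lim_n\int_{\{\lambda\in U:|p(\lambda)|\le n\}}p\,dE\,v$ on the domain of those $v$ for which the limit exists; if $p$ is $E$-essentially bounded on $U$ then $p(R)\in B(G)$. For $p:U\to\mathbb{C}$, $\widetilde{p}:\mathbb{C}\to\mathbb{C}$ is the extension of $p$ by $0$ outside $U$. For $t\in K$ (with $K\cdot U=\{t\lambda: t\in K,\lambda\in U\}\subseteq U$), $p_t:U\to\mathbb{C}$ is $p_t(\lambda)=p(t\lambda)$, and $p(tR)=p_t(R)$. For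 $f:\mathbb{C}\to\mathbb{C}$, $|f|_\infty^E=\inf_{\{\delta\in\mathcal{B}(\mathbb{C}):E(\delta)=\mathbf{1}\}}\sup_{\lambda\in\delta}|f(\lambda)|$. $\mathfrak{L}_E^\infty(U)$ is the seminormed space of all $f:\mathbb{C}\to\mathbb{C}$ such that $f$ restricted to $U$ is Borel and $|f\chi_U|_\infty^E<\infty$, with seminorm $\|f\|_\infty^E=|f\chi_U|_\infty^E$, where $\chi_U$ is the characteristic function of $U$. The space $F$: its underlying linear space is $L(\mathrm{Dom}(R),G)$, the space of all linear maps $\mathrm{Dom}(R)\to G$, with the locally convex topology generated by the seminorms $P\mapsto\|Pv\|$, $v\in\mathrm{Dom}(R)$. $j_{B(G)}^F:B(G)\to F$ is $T\mapsto T\restriction\mathrm{Dom}(R)$. $\widehat{F}$ is the Hausdorff completion of $F$ and $\mathfrak{i}_F:F\to\widehat{F}$ the canonical map. For $T\in B(G)$, $TR$ denotes the element $v\mapsto T(Rv)$ of $F$. $\mathcal{C}_u(W,\widehat{F})$ is the space of continuous maps $W\to\widehat{F}$ with the uniformity of uniform convergence on $W$; $\mathcal{C}^1(W,\widehat{F})$ is the linear space of differentiable maps $W\to\widehat{F}$ with continuous derivative, $\mathrm{D}h(t)=\lim_{s\to0}(h(t+s)-h(t))/s$.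
   Formalization: The compact space X is additionally assumed sequentially compact: for a general compact X (e.g. the Stone–Čech compactification of N, with all f^n and g zero) the sequence need not have a convergent subsequence, so the claim fails. *)

(* Defs.v *)
(* Built on MathComp, MathComp-Analysis and real-closed complex numbers. *)
From HB Require Import structures.
From mathcomp Require Import all_boot all_order all_algebra.
From mathcomp Require Import all_classical all_reals all_analysis.
From mathcomp Require Import complex.

Set Implicit Arguments.
Unset Strict Implicit.
Unset Printing Implicit Defensive.

Import Order.TTheory GRing.Theory Num.Theory.
Import numFieldNormedType.Exports.

Local Open Scope classical_set_scope.
Local Open Scope ring_scope.

(* The usual topology of the complex plane; the library only puts it on R[i]^o. *)
HB.instance Definition _ (R : rcfType) := NormedModule.copy R[i] R[i]^o.

Section Operators.
Context {K : numFieldType} (G : normedModType K).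

Record bounded_op := BoundedOp {
  bop_fun :> {linear G -> G};
  bop_continuous : continuous bop_fun }.

HB.instance Definition _ := gen_eqMixin bounded_op.
HB.instance Definition _ := gen_choiceMixin bounded_op.

Lemma bop_zero_continuous : continuous (\0 : {linear G -> G}).
Proof. by move=> x; exact: cvg_cst. Qed.

Definition bop_zero : bounded_op := BoundedOp bop_zero_continuous.

Definition subspace_of (S : submodClosed G) : Type := {v : G | v \in S}.

Section SubspaceOf.
Variable S : submodClosed G.
HB.instance Definition _ := SubChoice.on (subspace_of S).
HB.instance Definition _ := [SubChoice_isSubLmodule of subspace_of S by <:].
End SubspaceOf.

Record unbounded_op := UnboundedOp {
  op_dom : submodClosed G;
  op_fun :> {linear subspace_of op_dom -> G} }.

End Operators.
Notation Dom A := (subspace_of (op_dom A)).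

(* L(D, G) with the topology of the seminorms P |-> `|P v|, v : D, that is, the
   initial one for P |-> (P v)_v into the product D -> G. *)
Definition linear_maps {K : numFieldType} (D : lmodType K)
    (G : normedModType K) : Type :=
  initial_topology (fun P : {linear D -> G} => (P : D -> G) : {ptws D -> G}).

Section LinearMaps.
Context {K : numFieldType} (D : lmodType K) (G : normedModType K).
Local Notation F := (linear_maps D G).

HB.instance Definition _ := Uniform.on F.

Let fun_of (P : F) : D -> G := (P : {linear D -> G}).

Lemma linear_maps_ext (P Q : F) : fun_of P =1 fun_of Q -> P = Q.
Proof.
rewrite /fun_of; case: P Q => [p [[pA] [pZ]]] [q [[qA] [qZ]]] /= /funext pq.
move: pA pZ; rewrite pq => pA pZ.
by rewrite (Prop_irrelevance pA qA) (Prop_irrelevance pZ qZ).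
Qed.

Definition lm_zero : F := (\0 : {linear D -> G}).
Definition lm_opp (P : F) : F := (\- (P : {linear D -> G}) : {linear D -> G}).
Definition lm_add (P Q : F) : F :=
  ((P : {linear D -> G}) \+ (Q : {linear D -> G}) : {linear D -> G}).
Definition lm_scale (a : K) (P : F) : F :=
  (a \*: (P : {linear D -> G}) : {linear D -> G}).

Lemma lm_addA : associative lm_add.
Proof. by move=> P Q S; apply: linear_maps_ext => v; exact: addrA. Qed.
Lemma lm_addC : commutative lm_add.
Proof. by move=> P Q; apply: linear_maps_ext => v; exact: addrC. Qed.
Lemma lm_add0 : left_id lm_zero lm_add.
Proof. by move=> P; apply: linear_maps_ext => v; exact: add0r. Qed.
Lemma lm_addN : left_inverse lm_zero lm_opp lm_add.
Proof. by move=> P; apply: linear_maps_ext => v; exact: addNr. Qed.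

HB.instance Definition _ :=
  GRing.isZmodule.Build F lm_addA lm_addC lm_add0 lm_addN.

Lemma lm_scaleA a b P : lm_scale a (lm_scale b P) = lm_scale (a * b) P.
Proof. by apply: linear_maps_ext => v; exact: scalerA. Qed.
Lemma lm_scale1 : left_id 1 lm_scale.
Proof. by move=> P; apply: linear_maps_ext => v; exact: scale1r. Qed.
Lemma lm_scaleDr : right_distributive lm_scale +%R.
Proof. by move=> a P Q; apply: linear_maps_ext => v; exact: scalerDr. Qed.
Lemma lm_scaleDl P : {morph lm_scale^~ P : a b / a + b}.
Proof. by move=> a b; apply: linear_maps_ext => v; exact: scalerDl. Qed.

HB.instance Definition _ := GRing.Zmodule_isLmodule.Build K F
  lm_scaleA lm_scale1 lm_scaleDr lm_scaleDl.

End LinearMaps.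

(* (Fhat, i) is determined up to a unique isomorphism; a tvsType is a locally
   convex space, in general neither Hausdorff nor complete. *)
Record hausdorff_completion {K : numFieldType} {D : lmodType K}
    {G : normedModType K} (Fhat : tvsType K)
    (i : {linear linear_maps D G -> Fhat}) : Prop := HausdorffCompletion {
  completion_hausdorff : hausdorff_space Fhat;
  completion_complete : forall B : set_system Fhat,
    ProperFilter B -> cauchy B -> exists z : Fhat, B --> z;
  completion_dense : dense (range i);
  completion_entourage : forall B : set (linear_maps D G * linear_maps D G),
    entourage B <->
    exists2 A : set (Fhat * Fhat), entourage A & [set PQ | A (i PQ.1, i PQ.2)] `<=` B }.

Section Spectral.
Context {R : realType} {G : completeNormedModType R[i]}.
Local Notation C := R[i].
Local Notation borelC := (g_sigma_algebraType (@open C)).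
Implicit Types (E : set C -> bounded_op G) (U D : set C) (p : C -> C).
Implicit Types (A : unbounded_op G) (v w : G).

(* Only the values of E on Borel sets matter. *)
Record spectral_measure E : Prop := SpectralMeasure {
  spectral_measureT : forall v, E setT v = v;
  spectral_measureI : forall d1 d2 : set borelC,
    measurable d1 -> measurable d2 ->
    forall v, E (d1 `&` d2) v = E d1 (E d2 v);
  spectral_measure_sigma_additive : forall d : nat -> set borelC,
    (forall n, measurable (d n)) -> trivIset setT d ->
    forall v, \sum_(0 <= n < m) E (d n) v @[m --> \oo] -->
              E (\bigcup_n d n) v }.

Definition simple_fun (s : borelC -> borelC) : Prop :=
  measurable_fun setT s /\ finite_set (range s).

Definition simple_integral E D (s : borelC -> borelC) v : G :=
  \sum_(z \in range s) (z : C) *: E (D `&` s @^-1` [set z]) v.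

(* w = (\int_D p dE) v for p bounded and Borel on D: the limit of the integrals
   of simple functions converging to p uniformly on D. *)
Definition is_bounded_integral E D p v w : Prop :=
  exists s : nat -> C -> C,
    [/\ forall n, simple_fun (s n),
        {uniform D, s @ \oo --> p} &
        simple_integral E D (s n) v @[n --> \oo] --> w].

(* w = (\int_U p dE) v for p Borel on U; the v for which such a w exists form
   the domain of the operator p(R) on U. *)
Definition is_integral E U p v w : Prop :=
  exists I : nat -> G,
    (forall n, is_bounded_integral E [set l | U l /\ `|p l| <= n%:R] p v (I n))
    /\ I @ \oo --> w.

(* The graph of A is that of \int l dE(l). *)
Definition scalar_type A E : Prop :=
  spectral_measure E /\
  forall v w, (exists2 u : Dom A, val u = v & A u = w) <->
              is_integral E setT id v w.

Definition resolvent_set A : set C :=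
  [set z | exists T : bounded_op G,
     (forall v, exists2 u : Dom A, val u = T v & z *: val u - A u = v) /\
     (forall u : Dom A, T (z *: val u - A u) = val u)].

Definition spectrum A : set C := ~` resolvent_set A.

(* p(R) as an element of B(G); it is only meant for p that are E-essentially
   bounded on U, and is 0 when \int_U p dE is not in B(G). *)
Definition fun_calc E U p : bounded_op G :=
  xget (bop_zero G) [set T | forall v, is_integral E U p v (T v)].

Definition ext0 U p : C -> C := fun l => if l \in U then p l else 0.

Definition dilation p (t : R) : C -> C := fun l => p ((t%:C)%C * l).

(* The 0 only serves to make the supremum over an empty set 0. *)
Definition ess_norm E p : \bar R :=
  ereal_inf [set ereal_sup (0%E |` [set (Normc.normc (p l))%:E | l in d])
            | d in [set d : set borelC | measurable d /\ forall v, E d v = v]].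

Definition Linf_norm E U p : \bar R := ess_norm E (fun l => p l * \1_U l).

Definition in_Linf E U p : Prop :=
  measurable_fun (U : set borelC) (p : borelC -> borelC) /\
  (Linf_norm E U p < +oo)%E.

Definition continuous_Linf E U (X : topologicalType) (K : set R)
    (g : X -> R -> C -> C) : Prop :=
  (forall x t, K t -> in_Linf E U (g x t)) /\
  forall x t, K t -> forall e : R, 0 < e ->
    \forall q \near ((x, t) : X * R), K q.2 ->
      (Linf_norm E U (g q.1 q.2 \- g x t)%R < e%:E)%E.

Definition analytic_on U p : Prop :=
  forall z0, U z0 -> exists (a : nat -> C) (r : R), 0 < r /\
    forall z, `|z - z0| < (r%:C)%C ->
      \sum_(0 <= k < n) a k * (z - z0) ^+ k @[n --> \oo] --> p z.

Definition restrict_to_dom A (T : bounded_op G) : linear_maps (Dom A) G :=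
  (T \o (val : Dom A -> G) : {linear Dom A -> G}).

Definition comp_op A (T : bounded_op G) : linear_maps (Dom A) G :=
  (T \o A : {linear Dom A -> G}).

End Spectral.

Section CurvesInTvs.
Context {R : realType} {V : tvsType R[i]}.
Implicit Types (h : R -> V) (W : set R).

Definition has_deriv h (t : R) (l : V) : Prop :=
  ((s^-1)%:C)%C *: (h (t + s) - h t) @[s --> 0^'] --> l.

(* C^1(W, V) for W open; the values of h outside W are irrelevant. *)
Definition C1_on W h : Prop :=
  exists2 dh : R -> V, forall t, W t -> has_deriv h t (dh t) &
                       {within W, continuous dh}.

(* u converges to h in the space of continuous maps W -> V with the uniformity
   of uniform convergence on W. *)
Definition cvg_Cu W (u : nat -> R -> V) h : Prop :=
  [/\ forall k, {within W, continuous (u k)}, {within W, continuous h} &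
      {uniform W, u @ \oo --> h}].

End CurvesInTvs.

(* Not implied by compactness of X: it fails for the Stone-Cech
   compactification of nat. *)
Definition seq_compact (X : topologicalType) : Prop :=
  forall u : nat -> X, exists (y : X) (phi : nat -> nat),
    {homo phi : m n / (m < n)%N} /\ u \o phi @ \oo --> y.

(* Main.v *)
Require Import Defs.
From HB Require Import structures.
From mathcomp Require Import all_boot all_order all_algebra.
From mathcomp Require Import all_classical all_reals all_analysis.
From mathcomp Require Import complex ring lra.

(** For v in Dom(R) and a function f analytic on U, put P = f_t, P' = f_t' and
    k = t' - t. By the mean value inequality on the segment from t l to t' l,
    the quotient q(l) = (P'(l) - P(l)) / l differs from k c(l) by at most
    e |k| for almost every l as soon as the derivatives (df/dl)_s, s between t
    and t', are within e of c in the seminorm of L^oo_E(U).  Since q and q(l) l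
    are both bounded, f(t'R)v - f(tR)v = q(R)(Rv), which lies within a constant
    times e |k| |Rv| of k c(R)(Rv).

    Along a subsequence with x_n -> y, the maps g(x_n, .) converge uniformly on
    K to g(y, .) by compactness of K.  The estimate applied to f^n - f^m with
    c = 0 shows that t |-> f^n(tR)v is uniformly Cauchy, because it converges
    at t0; applied to f^n with c = g(y, t), it identifies the derivative of the
    limit.  As the topology of F is that of pointwise convergence, both facts
    pass to its completion. *)

Set Implicit Arguments.
Unset Strict Implicit.
Unset Printing Implicit Defensive.

Import Order.TTheory GRing.Theory Num.Theory.
Import numFieldNormedType.Exports.

Local Open Scope classical_set_scope.
Local Open Scope ring_scope.

(** * Real-valued norms *)

(** Two obstacles shape the proof. The derivative of f(t l) in t is l f'(t l), and only f' is
    controlled in L^oo_E(U); the product may be essentially unbounded, so there is no estimate in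
    operator norm. Dividing by l moves the missing factor onto v, as Rv. That (q id)(R)v = q(R)(Rv)
    when q and q id are bounded is proved on the disks |l| <= n, where the identity is
    multiplicativity of the integral, followed by a passage to the limit.

    The vector measure E(.)v need not have finite variation in norm, so integrals cannot be bounded
    by integrating a modulus. Instead, countable additivity bounds E(.)v for each v, uniform
    boundedness gives one constant M for all E(d), and convexity of the norm over finite sums bounds
    the integral of a simple function with |s| <= c by 4 c M |v|. Uniform limits cost another factor
    2, hence the constant 8 in all later estimates.

    The limit is formed in F itself: a pointwise limit of linear maps on Dom(R) is linear, and h is
    its image in the completion. *)

Section RealNorm.
Context {R : realType} {G : normedModType R[i]}.
Implicit Types (v w : G).

(* The norm of a complex normed module takes its values in R[i]. *)
Definition rnorm v : R := complex.Re `|v|.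

Lemma rnormE v : `|v| = ((rnorm v)%:C)%C.
Proof. by apply/esym/RRe_real; rewrite ger0_real. Qed.

Lemma rnorm_ge0 v : 0 <= rnorm v.
Proof. by rewrite -ler0c -rnormE. Qed.

Lemma rnorm0 : rnorm 0 = 0.
Proof. by rewrite /rnorm normr0. Qed.

Lemma rnorm_eq0 v : rnorm v = 0 -> v = 0.
Proof. by move=> v0; apply/normr0_eq0; rewrite rnormE v0. Qed.

Lemma rnormN v : rnorm (- v) = rnorm v.
Proof. by rewrite /rnorm normrN. Qed.

Lemma rnormBC v w : rnorm (v - w) = rnorm (w - v).
Proof. by rewrite -rnormN opprB. Qed.

Lemma rnormD v w : rnorm (v + w) <= rnorm v + rnorm w.
Proof. by rewrite -lecR rmorphD/= -!rnormE; exact: ler_normD. Qed.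

Lemma rnormB v w : rnorm (v - w) <= rnorm v + rnorm w.
Proof. by rewrite -(rnormN w); exact: rnormD. Qed.

Lemma rnorm_distD v w u : rnorm (v - u) <= rnorm (v - w) + rnorm (w - u).
Proof. by apply: le_trans (rnormD _ _); rewrite addrA subrK. Qed.

Lemma ltr_rnorm v (e : R) : (`|v| < (e%:C)%C) = (rnorm v < e).
Proof. by rewrite rnormE ltcR. Qed.

(** A positive element of [R[i]] is real, so epsilons may be taken in [R]. *)
Lemma cvg_rnorm T (F : set_system T) {FF : Filter F} (u : T -> G) (l : G) :
  u @ F --> l <-> forall e : R, 0 < e -> \forall x \near F, rnorm (l - u x) < e.
Proof.
split=> [/cvgrPdist_lt ul e e0|ul].
  have := ul (e%:C)%C; rewrite ltcR => /(_ e0).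
  by apply: filterS => x; rewrite ltr_rnorm.
apply/cvgrPdist_lt => e e0.
have er : e = ((complex.Re e)%:C)%C by apply/esym/RRe_real; rewrite gtr0_real.
have re0 : 0 < complex.Re e by rewrite -ltcR -er.
by apply: filterS (ul _ re0) => x; rewrite er ltr_rnorm.
Qed.

Lemma rnorm_lim_le T (F : set_system T) {FF : ProperFilter F} (u : T -> G)
    (l : G) (c : R) :
  u @ F --> l -> (\forall x \near F, rnorm (u x) <= c) -> rnorm l <= c.
Proof.
move=> /cvg_rnorm ul uc; apply/ler_addgt0Pr => e /ul ule.
have [x [uxc ulx]] := filter_ex (filterI uc ule).
rewrite -(subrK (u x) l); apply: le_trans (rnormD _ _) _.
by rewrite addrC lerD// ltW.
Qed.

Lemma nbhs_rnorm v (P : set G) :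
  nbhs v P <-> exists2 e : R, 0 < e & forall w, rnorm (v - w) < e -> P w.
Proof.
split=> [|[e e0 eP]].
  move=> /nbhs_normP[e /= e0 eP].
  have er : e = ((complex.Re e)%:C)%C by apply/esym/RRe_real; rewrite gtr0_real.
  exists (complex.Re e); first by rewrite -ltcR -er.
  by move=> w vw; apply: eP; rewrite /ball_/= er ltr_rnorm.
apply/nbhs_normP; exists (e%:C)%C; rewrite /= ?ltcR// => w.
by rewrite /ball_/= ltr_rnorm; exact: eP.
Qed.

End RealNorm.

Lemma rnormZ {R : realType} {G : normedModType R[i]} (z : R[i]) (v : G) :
  rnorm (z *: v) = rnorm z * rnorm v.
Proof.
apply: complexI; rewrite -rnormE normrZ rmorphM/=.
by rewrite -[RHS]/((rnorm z)%:C * (rnorm v)%:C)%C -!rnormE.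
Qed.

Lemma rnormM {R : realType} (z w : R[i]) : rnorm (z * w) = rnorm z * rnorm w.
Proof. exact: (rnormZ z w). Qed.

Lemma rnorm_normc {R : realType} (z : R[i]) : rnorm z = Normc.normc z.
Proof. by []. Qed.

Lemma rnorm_real {R : realType} (a : R) : rnorm ((a%:C)%C) = `|a|.
Proof. by rewrite rnorm_normc /= expr0n /= addr0 sqrtr_sqr. Qed.

Lemma rnorm_nat {R : realType} (n : nat) : rnorm (n%:R : R[i]) = n%:R.
Proof. by rewrite -(rmorph_nat (@real_complex_def R (Phant R))) rnorm_real ger0_norm. Qed.

Lemma rnormV {R : realType} (z : R[i]) : rnorm z^-1 = (rnorm z)^-1.
Proof. exact: Normc.normcV. Qed.

Lemma rnormX {R : realType} (z : R[i]) n : rnorm (z ^+ n) = rnorm z ^+ n.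
Proof.
elim: n => [|n IH]; first by rewrite !expr0 (rnorm_nat 1).
by rewrite !exprS rnormM IH.
Qed.


Lemma normRe_le {R : realType} (z : R[i]) : `|complex.Re z| <= rnorm z.
Proof. by rewrite -lecR -rnormE; exact: normc_ge_Re. Qed.

Lemma normIm_le {R : realType} (z : R[i]) : `|complex.Im z| <= rnorm z.
Proof.
rewrite rnorm_normc; case: z => x y /=.
by rewrite -sqrtr_sqr ler_wsqrtr// lerDr sqr_ge0.
Qed.

Lemma rnorm_sum {R : realType} {G : normedModType R[i]} I (r : seq I) (P : pred I)
    (F : I -> G) :
  rnorm (\sum_(i <- r | P i) F i) <= \sum_(i <- r | P i) rnorm (F i).
Proof.
elim/big_ind2 : _ => [|x y z w xy zw|//]; first by rewrite rnorm0.
by apply: le_trans (rnormD _ _) _; rewrite lerD.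
Qed.

Lemma rnorm_cauchy {R : realType} {G : completeNormedModType R[i]} (u : nat -> G) :
  (forall e : R, 0 < e -> exists N, forall m n, (N <= m)%N -> (N <= n)%N ->
     rnorm (u m - u n) < e) ->
  exists l : G, u @ \oo --> l.
Proof.
move=> uC; suff : cvg (u @ \oo) by move=> uc; exists (lim (u @ \oo)).
apply: cauchy_cvg; apply: cauchy_exP => e e0.
have er : e = ((complex.Re e)%:C)%C by apply/esym/RRe_real; rewrite gtr0_real.
have re0 : 0 < complex.Re e by rewrite -ltcR -er.
have [N NP] := uC _ re0.
exists (u N); exists N => // n /= Nn.
by rewrite -ball_normE /ball_/= er ltr_rnorm; exact: NP.
Qed.


(** * Uniform boundedness *)

Section ScaledSums.
Context {R : realType} {G : normedModType R[i]}.

(** A point of the cube [0, 1]^n is reached from its vertices by successive convex combinations, one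
    coordinate at a time, and the norm is convex. Masks are the vertices; [y] collects the terms of
    the coordinates already fixed. *)
Lemma convex_sum_bound (T : Type) (r : seq T) (x : T -> G) (a : T -> R)
    (y : G) (M : R) :
  (forall i, 0 <= a i <= 1) ->
  (forall m : bitseq, rnorm (y + \sum_(i <- mask m r) x i) <= M) ->
  rnorm (y + \sum_(i <- r) ((a i)%:C)%C *: x i) <= M.
Proof.
move=> a01; elim: r y => [|h r IH] y yM.
  by have := yM [::]; rewrite /= !big_nil.
have y0 := IH y (fun m => yM (false :: m)).
have y1 : rnorm (y + x h + \sum_(i <- r) ((a i)%:C)%C *: x i) <= M.
  by apply: IH => m; have := yM (true :: m); rewrite /= big_cons addrA.
rewrite big_cons; set S := \sum_(_ <- _) _ in y0 y1 *.
have -> : y + (((a h)%:C)%C *: x h + S) =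
    ((1 - a h)%:C)%C *: (y + S) + ((a h)%:C)%C *: (y + x h + S).
  rewrite (addrAC y (x h)) (scalerDr _ (y + S)) [in RHS]addrA -scalerDl.
  by rewrite -rmorphD/= subrK scale1r (addrC (_ *: x h)) addrA.
have /andP[a0 a1] := a01 h.
apply: le_trans (rnormD _ _) _; rewrite !rnormZ !rnorm_real.
rewrite !ger0_norm ?subr_ge0//.
have := ler_wpM2l a0 y1; have a1' : 0 <= 1 - a h by rewrite subr_ge0.
by have := ler_wpM2l a1' y0; lra.
Qed.

(** The factor 4 counts positive and negative parts of real and imaginary parts; each of them
    divided by [c] has coefficients in [0, 1]. *)
Lemma scaled_sum_bound (T : Type) (r : seq T) (x : T -> G) (z : T -> R[i])
    (c M : R) :
  0 < c -> (forall i, rnorm (z i) <= c) ->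
  (forall m : bitseq, rnorm (\sum_(i <- mask m r) x i) <= M) ->
  rnorm (\sum_(i <- r) z i *: x i) <= 4 * c * M.
Proof.
move=> c0 zc xM.
have S01 (a : T -> R) : (forall i, `|a i| <= c) ->
    rnorm (\sum_(i <- r) ((Num.max (a i) 0 / c)%:C)%C *: x i) <= M.
  move=> ac; rewrite -[X in rnorm X]add0r; apply: convex_sum_bound => [i|m].
    rewrite divr_ge0 ?le_max ?lexx ?orbT ?(ltW c0)//= ler_pdivrMr// mul1r.
    by rewrite ge_max (ltW c0) andbT (le_trans (ler_norm _)).
  by rewrite add0r.
have Sr (a : T -> R) : (forall i, `|a i| <= c) ->
    rnorm (\sum_(i <- r) ((a i)%:C)%C *: x i) <= 2 * c * M.
  move=> ac.
  have -> : \sum_(i <- r) ((a i)%:C)%C *: x i = (c%:C)%C *: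
      (\sum_(i <- r) ((Num.max (a i) 0 / c)%:C)%C *: x i -
       \sum_(i <- r) ((Num.max (- a i) 0 / c)%:C)%C *: x i).
    rewrite -sumrB scaler_sumr; apply: eq_bigr => i _.
    rewrite -scalerBl scalerA -rmorphB -rmorphM/=; congr (((_)%:C)%C *: _).
    rewrite -mulrBl mulrCA divff ?gt_eqF// mulr1.
    by case: (leP (a i) 0) => ai; case: leP => ai'; lra.
  rewrite rnormZ rnorm_real gtr0_norm// (mulrC 2) -mulrA ler_pM2l//.
  apply: le_trans (rnormB _ _) _.
  have := S01 a ac; have := S01 (fun i => - a i).
  by move=> /(_ (fun i => eq_ind_r (fun t => t <= c) (ac i) (normrN _))); lra.
have -> : \sum_(i <- r) z i *: x i =
    \sum_(i <- r) ((complex.Re (z i))%:C)%C *: x i +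
    'i%C *: \sum_(i <- r) ((complex.Im (z i))%:C)%C *: x i.
  rewrite scaler_sumr -big_split/=; apply: eq_bigr => i _.
  by rewrite scalerA -scalerDl -complexE.
apply: le_trans (rnormD _ _) _; rewrite rnormZ.
have -> : rnorm ('i%C : R[i]) = 1.
  by rewrite rnorm_normc /= expr0n /= add0r expr1n sqrtr1.
have := Sr (fun i => complex.Re (z i)) (fun i => le_trans (normRe_le _) (zc i)).
have := Sr (fun i => complex.Im (z i)) (fun i => le_trans (normIm_le _) (zc i)).
by lra.
Qed.

End ScaledSums.

Section UniformBoundedness.
Context {R : realType} {G : completeNormedModType R[i]}.

(** Baire's argument made explicit: otherwise there are nested closed balls on the n-th of which
    some [T i] exceeds n everywhere, and the family is unbounded at their common point. *)
Lemma bounded_on_ball (I : Type) (P : set I) (T : I -> bounded_op G) :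
  (forall v, exists M : R, forall i, P i -> rnorm (T i v) <= M) ->
  exists (x : G) (r M : R), 0 < r /\
    forall i y, P i -> rnorm (y - x) <= r -> rnorm (T i y) <= M.
Proof.
move=> bT; apply: contrapT => nT.
(* A pair is a centre and a radius. Moving the centre by at most half the radius and at least
   halving the radius keeps the new closed ball inside the old one. *)
have step (n : nat) (p : G * R) : exists q : G * R, 0 < p.2 ->
    [/\ 0 < q.2, q.2 <= p.2 / 2, rnorm (q.1 - p.1) <= p.2 / 2 &
     exists2 i, P i & forall y, rnorm (y - q.1) <= q.2 -> n%:R < rnorm (T i y)].
  have [p0|p0] := leP p.2 0; first by exists p => p0'; lra.
  have [[i y] [Pi yp Tiy]] : exists iy : I * G,
      [/\ P iy.1, rnorm (iy.2 - p.1) <= p.2 / 2 & n%:R < rnorm (T iy.1 iy.2)].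
    apply: contrapT => nM; apply: nT; exists p.1, (p.2 / 2), n%:R.
    split=> [|i y Pi yp]; first by lra.
    by rewrite leNgt; apply/negP => Tiy; apply: nM; exists (i, y).
  have e0 : 0 < rnorm (T i y) - n%:R by rewrite subr_gt0.
  have /cvg_rnorm/(_ _ e0)/nbhs_rnorm[d d0 dP] := @bop_continuous _ _ (T i) y.
  exists (y, Num.min (d / 2) (p.2 / 2)) => _ /=; split => //.
  - by rewrite lt_min; apply/andP; split; lra.
  - by rewrite ge_min lexx orbT.
  exists i => // w; rewrite le_min => /andP[wd _].
  have /dP : rnorm (y - w) < d by rewrite rnormBC; lra.
  have := rnorm_distD (T i y) (T i w) 0; rewrite !subr0; lra.
have [f fP] := choice (fun np : nat * (G * R) => step np.1 np.2).
pose s := fix s n := if n is m.+1 then f (m, s m) else (0, 1).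
have s0 n : 0 < (s n).2.
  elim: n => [|n IH] /=; first exact: ltr01.
  by have [] := fP (n, s n) IH.
have sP n : [/\ (s n.+1).2 <= (s n).2 / 2, rnorm ((s n.+1).1 - (s n).1) <= (s n).2 / 2 &
    exists2 i, P i & forall y, rnorm (y - (s n.+1).1) <= (s n.+1).2 -> n%:R < rnorm (T i y)].
  by have [_ h1 h2 h3] := fP (n, s n) (s0 n).
have s01 : (s 0%N).2 = 1 by [].
clearbody s.
have nest n k : rnorm ((s (n + k)%N).1 - (s n).1) + (s (n + k)%N).2 <= (s n).2.
  elim: k => [|k IH]; first by rewrite addn0 subrr rnorm0 add0r.
  rewrite addnS; have [h1 h2 _] := sP (n + k)%N.
  apply: le_trans IH; have := rnorm_distD (s (n + k).+1).1 (s (n + k)%N).1 (s n).1.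
  lra.
have s2 n : (s n).2 <= n.+1%:R^-1.
  elim: n => [|n IH]; first by rewrite s01 invr1.
  have [h1 _ _] := sP n; apply: le_trans h1 _.
  rewrite ler_pdivrMr//; apply: le_trans IH _.
  rewrite [leRHS]mulrC ler_pdivlMr ?ltr0n// mulrC ler_pdivrMr ?ltr0n//.
  by rewrite -natrM ler_nat mul2n -addnn addSn ltnS addnS ltnS leq_addl.
have [l sl] : exists l : G, (fun n => (s n).1) @ \oo --> l.
  apply: rnorm_cauchy => e e0.
  have e2 : 0 < e / 2 by lra.
  have [N _ NP] := near_infty_natSinv_lt (PosNum e2).
  exists N => m n Nm Nn; have := NP N (leqnn N); rewrite /= => Ne.
  have := nest N (m - N)%N; have := nest N (n - N)%N; rewrite !subnKC//.
  have := s0 m; have := s0 n.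
  have := rnorm_distD (s m).1 (s N).1 (s n).1; rewrite (rnormBC (s N).1).
  by have := le_lt_trans (s2 N) Ne; rewrite /=; lra.
have ln n : rnorm (l - (s n).1) <= (s n).2.
  have sl' : (fun m => (s m).1 - (s n).1) @ \oo --> l - (s n).1.
    by apply: cvgB => //; exact: cvg_cst.
  apply: (rnorm_lim_le sl'); exists n => // m /= nm.
  by have := nest n (m - n)%N; rewrite subnKC//; have := s0 m; lra.
have [M MP] := bT l.
have [_ _ [i Pi iP]] := sP (Num.bound (Num.max M 0)).
have := iP l (ln _.+1); have := MP _ Pi; rewrite /=.
have := archi_boundP (_ : 0 <= Num.max M 0); rewrite le_max lexx orbT.
have : M <= Num.max M 0 by rewrite le_max lexx.
by move=> h1 /(_ isT); lra.
Qed.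

(** A multiple of [v] of norm [r] is the difference of two points of the ball where the family is
    bounded by [M], which gives the constant [2 * M / r]. *)
Lemma uniform_boundedness (I : Type) (P : set I) (T : I -> bounded_op G) :
  (forall v, exists M : R, forall i, P i -> rnorm (T i v) <= M) ->
  exists2 M : R, 0 < M & forall i v, P i -> rnorm (T i v) <= M * rnorm v.
Proof.
move=> /bounded_on_ball[x [r [M [r0 bM]]]].
(* The absolute value and the added 1 make the constant positive even for an empty family, when [M]
   may be negative. *)
exists (2 * `|M| / r + 1).
  by apply: ltr_wpDl => //; rewrite divr_ge0 ?mulr_ge0 ?(ltW r0).
move=> i v Pi; have [->|v0] := eqVneq v 0.
  by rewrite linear0 rnorm0 mulr0.
have nv0 : 0 < rnorm v.
  rewrite lt_neqAle rnorm_ge0 andbT; apply: contra v0 => /eqP/esym/rnorm_eq0 ->.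
  exact: eqxx.
pose k : R := r / rnorm v.
have k0 : 0 < k by rewrite divr_gt0.
have h1 : rnorm (T i (x + (k%:C)%C *: v)) <= M.
  apply: bM => //; rewrite addrAC subrr add0r rnormZ rnorm_real gtr0_norm//.
  by rewrite /k divfK// gt_eqF.
have h0 : rnorm (T i x) <= M by apply: bM => //; rewrite subrr rnorm0 ltW.
have : k * rnorm (T i v) <= 2 * `|M|.
  rewrite -[k in leLHS]gtr0_norm// -(rnorm_real k) -rnormZ -linearZ.
  have -> : T i ((k%:C)%C *: v) = T i (x + (k%:C)%C *: v) - T i x.
    by rewrite linearD addrAC subrr add0r.
  apply: le_trans (rnormB _ _) _; have := ler_norm M; lra.
move=> h.
have -> : rnorm (T i v) = k * rnorm (T i v) * (rnorm v / r).
  by rewrite /k; field; rewrite !gt_eqF.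
have -> : (2 * `|M| / r + 1) * rnorm v = 2 * `|M| * (rnorm v / r) + rnorm v.
  by ring.
apply: ler_wpDr; first exact: ltW.
by rewrite ler_wpM2r// divr_ge0// ltW.
Qed.

End UniformBoundedness.

(** * Spectral measures *)

Lemma series_term_small {R : realType} {G : normedModType R[i]} (u : nat -> G)
    (l : G) (e : R) :
  \sum_(0 <= n < m) u n @[m --> \oo] --> l -> 0 < e -> exists n, rnorm (u n) < e.
Proof.
move=> /cvg_rnorm ul e0; have e2 : 0 < e / 2 by lra.
have [N _ NP] := ul _ e2; exists N.
have := NP N (leqnn N); have := NP N.+1 (leqnSn N); rewrite /= big_nat_recr//=.
set S := \sum_(_ <= _ < _) _ => h1 h2.
have -> : u N = (l - S) - (l - (S + u N)).
  by rewrite opprB addrA (addrA (l - S)) subrK addrAC subrr add0r.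
by apply: le_lt_trans (rnormB _ _) _; lra.
Qed.

Section SpectralMeasure.
Context {R : realType} {G : completeNormedModType R[i]}.
Local Notation borelC := (g_sigma_algebraType (@open R[i])).
Variable E : set R[i] -> bounded_op G.
Hypothesis sE : spectral_measure E.
Implicit Types (A B : set borelC) (d : nat -> set borelC) (v : G).

(** The constant sequence of empty sets is disjoint, so a series all of whose terms are [E set0 v]
    converges. *)
Lemma spectral_measure0 v : E set0 v = 0.
Proof.
have := @spectral_measure_sigma_additive _ _ _ sE (fun=> (set0 : set borelC))
  (fun=> measurable0) _ v.
rewrite bigcup0//; have tI : trivIset setT (fun _ : nat => set0 : set borelC).
  by move=> i j _ _ [x []].
move=> /(_ tI) sv.
apply/rnorm_eq0/eqP; rewrite eq_le rnorm_ge0 andbT.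
apply/ler_addgt0Pr => e e0; rewrite add0r.
by have [_ /ltW] := series_term_small sv e0.
Qed.

Lemma spectral_measureU A B v : measurable A -> measurable B ->
  A `&` B = set0 -> E (A `|` B) v = E A v + E B v.
Proof.
move=> mA mB AB.
have mAB n : measurable (bigcup2 A B n) by case: n => [|[|n]] //=; exact: measurable0.
have tI : trivIset setT (bigcup2 A B).
  by rewrite -trivIset_bigcup2.
have := @spectral_measure_sigma_additive _ _ _ sE _ mAB tI v; rewrite bigcup2E => sv.
have {}sv := @cvg_unique _ (@norm_hausdorff _ G) _ _ _ _ sv.
apply: sv; apply: cvg_near_cst; exists 2%N => // n /= n2.
rewrite -(subnKC n2) /index_iota subn0 iotaD big_cat/=.
rewrite big_cons big_cons big_nil addr0 big1_seq ?addr0//= => i.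
rewrite mem_iota => /andP[i2 _]; rewrite -(subnKC i2) /bigcup2/=.
exact: spectral_measure0.
Qed.

Lemma spectral_measureD A B v : measurable A -> measurable B ->
  B `<=` A -> E (A `\` B) v = E A v - E B v.
Proof.
move=> mA mB BA; apply/eqP; rewrite -subr_eq opprK; apply/eqP.
rewrite -spectral_measureU ?setDKU//; first exact: measurableD.
exact: setDKI.
Qed.

Lemma spectral_measure_split A B v : measurable A -> measurable B ->
  E A v = E (A `&` B) v + E (A `\` B) v.
Proof.
move=> mA mB; rewrite -spectral_measureU.
- by rewrite setUIDK.
- exact: measurableI.
- exact: measurableD.
by apply/seteqP; split=> // x [[_ Bx] [_ nBx]].
Qed.

(* Were the values unbounded, one could repeatedly split off from a set on which
   they are unbounded a piece of measure larger than 1, against additivity. *)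
Lemma spectral_measure_ptbounded v :
  exists M : R, forall A, measurable A -> rnorm (E A v) <= M.
Proof.
apply: contrapT => nb.
pose bad A := measurable A /\
  ~ exists M : R, forall B, measurable B -> B `<=` A -> rnorm (E B v) <= M.
have badT : bad setT.
  by split=> // -[M MP]; apply: nb; exists M => A mA; exact: MP.
have step A : exists B, bad A -> [/\ bad B, B `<=` A & 1 < rnorm (E (A `\` B) v)].
  have [bA|nbA] := pselect (bad A); last by exists A => /nbA.
  have [mA nA] := bA.
  (* With this margin both [C] and its complement in [A] have measure larger than 1, so whichever of
     the two is bad can be kept and the other split off. At least one is bad, since bounds on both
     would add up to a bound on [A]. *)
  have [C [mC CA Cbig]] : exists C, [/\ measurable C, C `<=` A &
      rnorm (E A v) + 1 < rnorm (E C v)].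
    apply: contrapT => nC; apply: nA; exists (rnorm (E A v) + 1) => B mB BA.
    by rewrite leNgt; apply/negP => h; apply: nC; exists B.
  have D1 : 1 < rnorm (E (A `\` C) v).
    rewrite spectral_measureD//.
    have := rnorm_distD (E C v) (E A v) 0; rewrite !subr0 rnormBC; lra.
  have AC : A `\` (A `\` C) = C by rewrite setDD setIC (setIidl CA).
  have [bC|nbC] := pselect (bad C).
    by exists C => _; split.
  exists (A `\` C) => _; split; last 2 first.
  - exact: subDsetl.
  - by rewrite AC; have := rnorm_ge0 (E A v); lra.
  split; first exact: measurableD.
  move=> [M1 M1P]; apply: nbC; split=> // -[M2 M2P]; apply: nA.
  exists (M1 + M2) => B mB BA; rewrite (spectral_measure_split v mB mC) addrC.
  apply: le_trans (rnormD _ _) _; apply: lerD.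
    by apply: M1P; [exact: measurableD|move=> x [Bx nCx]; split=> //; exact: BA].
  by apply: M2P; [exact: measurableI|exact: subIsetr].
have [f fP] := choice step.
pose s := fix s n : set borelC := if n is m.+1 then f (s m) else setT.
have sbad n : bad (s n) by elim: n => // n IH; have [] := fP _ IH.
have sS n : s n.+1 `<=` s n by have [] := fP _ (sbad n).
have s1 n : 1 < rnorm (E (s n `\` s n.+1) v) by have [] := fP _ (sbad n).
have sdecr m n : (m <= n)%N -> s n `<=` s m.
  move=> /subnKC <-; elim: (n - m)%N => [|k IH]; first by rewrite addn0.
  by rewrite addnS; exact: subset_trans (sS _) IH.
have ms n : measurable (s n `\` s n.+1).
  by apply: measurableD; [have [] := sbad n|have [] := sbad n.+1].
have tI : trivIset setT (fun n => s n `\` s n.+1).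
  apply: ltn_trivIset => n m mn.
  by apply/seteqP; split=> // x [[_ nx] [sx _]]; apply: nx; exact: sdecr sx.
have := @spectral_measure_sigma_additive _ _ _ sE _ ms tI v.
move=> /series_term_small /(_ ltr01)[n].
by rewrite ltNge ltW.
Qed.

Lemma spectral_measure_bounded : exists2 M : R, 0 < M &
  forall A, measurable A -> forall v, rnorm (E A v) <= M * rnorm v.
Proof.
have [v|M M0 MP] := @uniform_boundedness _ _ (set borelC) measurable E.
  by have [M MP] := spectral_measure_ptbounded v; exists M.
by exists M => // A mA v; exact: MP.
Qed.

Lemma spectral_measure_cvg d v : (forall n, measurable (d n)) ->
  nondecreasing_seq d -> E (d n) v @[n --> \oo] --> E (\bigcup_n d n) v.
Proof.
move=> md nd; rewrite -eq_bigcup_seqD.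
have mD n : measurable (seqD d n) by case: n => [|n] //=; exact: measurableD.
have := @spectral_measure_sigma_additive _ _ _ sE _ mD (trivIset_seqD nd) v.
rewrite -(cvg_shiftS (fun m => \sum_(0 <= n < m) _)).
suff H n : \sum_(0 <= k < n.+1) E (seqD d k) v = E (d n) v.
  by under eq_fun do rewrite H.
elim: n => [|n IH]; first by rewrite big_nat1.
rewrite big_nat_recr//= IH spectral_measureD//; last by apply/subsetPset; exact: nd.
by rewrite addrC subrK.
Qed.


Lemma spectral_measure_setI A B : measurable A -> measurable B ->
  (forall v, E A v = v) -> (forall v, E B v = v) -> forall v, E (A `&` B) v = v.
Proof. by move=> mA mB EA EB v; rewrite spectral_measureI// EB. Qed.

(** The complements of the finite intersections increase and are null, so their union is null by
    continuity from below. This is what allows countably many exceptional sets to be discarded at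
    once. *)
Lemma spectral_measure_bigcap d : (forall n, measurable (d n)) ->
  (forall n v, E (d n) v = v) -> forall v, E (\bigcap_n d n) v = v.
Proof.
move=> md Ed v.
pose c := fix c n : set borelC := if n is m.+1 then c m `|` ~` d n else ~` d 0%N.
have mc n : measurable (c n).
  by elim: n => [|n IH] /=; [exact: measurableC|apply: measurableU => //; exact: measurableC].
have Ec n : forall w, E (~` c n) w = w.
  elim: n => [|n IH] w /=; first by rewrite setCK.
  by rewrite setCU setCK; apply: spectral_measure_setI => //; exact: measurableC.
have nc : nondecreasing_seq c.
  by apply/nondecreasing_seqP => n; apply/subsetPset => x cx; left.
have cE : \bigcap_n d n = ~` \bigcup_n c n.
  apply/seteqP; split=> x.
    move=> dx [n _]; elim: n => [|n IH] /=; first by apply; exact: dx.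
    by move=> [/IH//|]; apply; exact: dx.
  by move=> ncx n _; apply: contrapT => ndx; apply: ncx; exists n => //; case: n ndx => [|n] ndx //; right.
have E0 n : E (c n) v = 0.
  have := spectral_measure_split v measurableT (mc n).
  rewrite setTI setTD Ec (spectral_measureT sE) => /esym/eqP.
  by rewrite -[X in _ == X]add0r => /eqP/addIr.
have : E (c n) v @[n --> \oo] --> E (\bigcup_n c n) v by exact: spectral_measure_cvg.
under eq_fun do rewrite E0.
move=> /cvg_unique-/(_ (@norm_hausdorff _ G) _ (cvg_cst 0)) c0.
have mU : measurable (\bigcup_n c n) by exact: bigcup_measurable.
have := spectral_measure_split v measurableT mU.
by rewrite setTI setTD c0 add0r (spectral_measureT sE) cE => <-.
Qed.

End SpectralMeasure.

(** * Simple and bounded integrals *)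

Section SimpleIntegral.
Context {R : realType} {G : completeNormedModType R[i]}.
Local Notation borelC := (g_sigma_algebraType (@open R[i])).
Implicit Types (s : R[i] -> R[i]) (D : set borelC) (v : G).

Lemma borel_open (A : set R[i]) : open A -> measurable (A : set borelC).
Proof. by move=> oA; exact: sub_sigma_algebra. Qed.

Lemma borel_set1 (z : R[i]) : measurable ([set z] : set borelC).
Proof.
rewrite -[X in measurable X]setCK; apply: measurableC; apply: borel_open.
rewrite openC; apply: (@compact_closed R[i]); last exact: compact_set1.
exact: (@norm_hausdorff _ R[i]).
Qed.

Lemma simple_fun_fiber s z : simple_fun s -> measurable (s @^-1` [set z] : set borelC).
Proof.
by move=> [ms _]; rewrite -[X in measurable X]setTI; apply: ms => //; exact: borel_set1.
Qed.

Lemma simple_funP s : finite_set (range s) ->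
  (forall z, measurable (s @^-1` [set z] : set borelC)) -> simple_fun s.
Proof.
move=> fs ms; split=> // _ Y mY; rewrite setTI.
have -> : s @^-1` Y = \bigcup_(z in range s `&` Y) s @^-1` [set z].
  apply/seteqP; split=> [l sY|l [z [_ Yz] /= lz]]; last by rewrite /preimage/= lz.
  by exists (s l) => //; split=> //; exists l.
by apply: fin_bigcup_measurable => [|z _]; [exact: finite_setIl|exact: ms].
Qed.

Definition values s : seq R[i] := finmap.enum_fset (fset_set (range s)).

Lemma values_uniq s : uniq (values s).
Proof. exact: finmap.fset_uniq. Qed.

Lemma mem_values s l : simple_fun s -> s l \in values s.
Proof. by move=> [_ fs]; rewrite in_fset_set// inE; exists l. Qed.

Variable E : set R[i] -> bounded_op G.
Hypothesis sE : spectral_measure E.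

Lemma spectral_measure_fin (T : eqType) (u : R[i] -> T) (r : seq T) D v :
  uniq r -> measurable D -> (forall y, measurable (u @^-1` [set y] : set borelC)) ->
  measurable (u @^-1` [set` r] : set borelC) /\
  E (D `&` u @^-1` [set` r]) v = \sum_(y <- r) E (D `&` u @^-1` [set y]) v.
Proof.
move=> ur mD mu; elim: r ur => [_|y r IH /= /andP[yr ur]].
  have -> : u @^-1` [set` [::]] = set0 by apply/seteqP; split.
  by split; [exact: measurable0|rewrite setI0 big_nil spectral_measure0].
have [mr rE] := IH ur; have -> : u @^-1` [set` y :: r] =
    u @^-1` [set y] `|` u @^-1` [set` r].
  apply/seteqP; split=> l /=; rewrite inE.
    by move=> /orP[/eqP|]; [left|right].
  by move=> [->|->]; rewrite ?eqxx ?orbT.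
split; first exact: measurableU.
rewrite big_cons -rE setIUr spectral_measureU//; try exact: measurableI.
apply/seteqP; split=> // l [[_ /= uy] [_ /= ur']].
by move: yr; rewrite -uy ur'.
Qed.

(** The integral may be computed on any finite partition finer than the one into fibres of [s].
    Taking for [u] the pair of two simple functions puts both on a common partition, from which all
    algebraic rules follow. *)
Lemma simple_integral_refine (T : eqType) (u : R[i] -> T) (r : seq T)
    (h : T -> R[i]) s D v :
  simple_fun s -> uniq r -> (forall l, u l \in r) -> measurable D ->
  (forall y, measurable (u @^-1` [set y] : set borelC)) -> s =1 h \o u ->
  simple_integral E D s v = \sum_(y <- r) h y *: E (D `&` u @^-1` [set y]) v.
Proof.
move=> ss ur ru mD mu su; rewrite /simple_integral fsbig_finite/=; last exact: ss.2.
rewrite -/(values s).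
transitivity (\sum_(z <- values s) \sum_(y <- r | h y == z)
    h y *: E (D `&` u @^-1` [set y]) v).
  apply: eq_bigr => z _.
  have -> : s @^-1` [set z] = u @^-1` [set` [seq y <- r | h y == z]].
    apply/seteqP; split=> l /=; rewrite su/= mem_filter ru andbT.
      by move=> /eqP.
    by move=> /eqP.
  rewrite (spectral_measure_fin _ _ _ _).2 ?filter_uniq//.
  rewrite scaler_sumr big_filter; apply: eq_bigr => y /eqP <-//.
rewrite (exchange_big_dep xpredT)//=; apply: eq_bigr => y _.
have [yV|yV] := boolP (h y \in values s).
  rewrite -big_filter (@eq_filter _ _ (pred1 (h y))); last first.
    by move=> z /=; rewrite eq_sym.
  by rewrite filter_pred1_uniq ?values_uniq// big_seq1.
(* An index [y] whose image under [h] is not a value of [s] has an empty fibre. *)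
rewrite big1_seq; last by move=> z /andP[/eqP <-]; rewrite (negPf yV).
have -> : u @^-1` [set y] = set0.
  by apply/seteqP; split=> // l /= uy; move: yV; rewrite -uy -[h (u l)]/((h \o u) l) -su mem_values.
by rewrite setI0 spectral_measure0// scaler0.
Qed.

Lemma simple_integral_sum s D v : simple_fun s -> measurable D ->
  simple_integral E D s v = \sum_(z <- values s) z *: E (D `&` s @^-1` [set z]) v.
Proof.
move=> ss mD; apply: (simple_integral_refine (u := s) (h := id)) => //.
- exact: values_uniq.
- by move=> l; exact: mem_values.
- by move=> z; exact: simple_fun_fiber.
Qed.

Section Pair.
Variables (s t : R[i] -> R[i]) (ss : simple_fun s) (st : simple_fun t).
Let u l := (s l, t l).

Lemma pair_fiber y : measurable (u @^-1` [set y] : set borelC).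
Proof.
have -> : u @^-1` [set y] = s @^-1` [set y.1] `&` t @^-1` [set y.2].
  by apply/seteqP; split=> l /=; [move=> <-|rewrite /u; case: y => a b [/= -> ->]].
by apply: measurableI; exact: simple_fun_fiber.
Qed.

Lemma simple_fun_comp2 (h : R[i] * R[i] -> R[i]) : simple_fun (h \o u).
Proof.
have fu : finite_set (range u).
  apply: (@sub_finite_set _ _ (range s `*` range t)).
    by move=> _ [l _ <-]; split; exists l.
  by apply: finite_setX; [exact: ss.2|exact: st.2].
apply: simple_funP => [|z]; first by rewrite -(image_comp u h); exact: finite_image.
have -> : (h \o u) @^-1` [set z] = \bigcup_(y in range u `&` h @^-1` [set z]) u @^-1` [set y].
  apply/seteqP; split=> [l uz|l [y [_ Yz] /= ly]]; last by rewrite /preimage/= ly.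
  by exists (u l) => //; split=> //; exists l.
by apply: fin_bigcup_measurable => [|y _]; [exact: finite_setIl|exact: pair_fiber].
Qed.

Lemma simple_integral_comp2 (h : R[i] * R[i] -> R[i]) D v : measurable D ->
  simple_integral E D (h \o u) v =
  \sum_(y <- [seq (a, b) | a <- values s, b <- values t])
    h y *: E (D `&` u @^-1` [set y]) v.
Proof.
move=> mD; apply: simple_integral_refine => //.
- exact: simple_fun_comp2.
- by apply: allpairs_uniq; rewrite ?values_uniq// => -[? ?] [? ?].
- by move=> l; apply/allpairsP; exists (u l); split; rewrite ?mem_values.
- exact: pair_fiber.
Qed.

Lemma simple_funD : simple_fun (s \+ t).
Proof. exact: (simple_fun_comp2 (fun y => y.1 + y.2)). Qed.

Lemma simple_funB : simple_fun (s \- t).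
Proof. exact: (simple_fun_comp2 (fun y => y.1 - y.2)). Qed.

Lemma simple_funM : simple_fun (s \* t).
Proof. exact: (simple_fun_comp2 (fun y => y.1 * y.2)). Qed.

Lemma simple_integralD D v : measurable D ->
  simple_integral E D (s \+ t) v = simple_integral E D s v + simple_integral E D t v.
Proof.
move=> mD; rewrite (simple_integral_comp2 (fun y => y.1 + y.2))//.
rewrite (simple_integral_comp2 fst)// (simple_integral_comp2 snd)// -big_split/=.
by apply: eq_bigr => y _; rewrite scalerDl.
Qed.

Lemma simple_integralB D v : measurable D ->
  simple_integral E D (s \- t) v = simple_integral E D s v - simple_integral E D t v.
Proof.
move=> mD; rewrite (simple_integral_comp2 (fun y => y.1 - y.2))//.
rewrite (simple_integral_comp2 fst)// (simple_integral_comp2 snd)// -sumrB/=.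
by apply: eq_bigr => y _; rewrite scalerBl.
Qed.

(** Multiplicativity of [E] on the fibres. The two domains are independent so that one factor can be
    a truncation of an unbounded function. *)
Lemma simple_integralM D D' v : measurable D -> measurable D' ->
  simple_integral E (D `&` D') (s \* t) v =
  simple_integral E D s (simple_integral E D' t v).
Proof.
move=> mD mD'; rewrite (simple_integral_comp2 (fun y => y.1 * y.2)); last exact: measurableI.
rewrite simple_integral_sum// big_allpairs; apply: eq_bigr => a _.
rewrite simple_integral_sum// linear_sum/= scaler_sumr; apply: eq_bigr => b _.
rewrite linearZ/= scalerA -spectral_measureI//; last 2 first.
- by apply: measurableI => //; exact: simple_fun_fiber.
- by apply: measurableI => //; exact: simple_fun_fiber.
congr (_ *: E _ _); rewrite setIACA; congr (_ `&` _).
by apply/seteqP; split=> l /=; [move=> [<- <-]|move=> [? ?]; congr pair].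
Qed.

End Pair.

Lemma simple_funZ s (a : R[i]) : simple_fun s -> simple_fun (fun l => a * s l).
Proof. by move=> ss; exact: (simple_fun_comp2 ss ss (fun y => a * y.1)). Qed.

Lemma simple_integralZ s (a : R[i]) D v : simple_fun s -> measurable D ->
  simple_integral E D (fun l => a * s l) v = a *: simple_integral E D s v.
Proof.
move=> ss mD; rewrite (simple_integral_comp2 ss ss (fun y => a * y.1))//.
rewrite (simple_integral_comp2 ss ss fst)// scaler_sumr.
by apply: eq_bigr => y _; rewrite scalerA.
Qed.

Lemma simple_integralDr s D v w : measurable D -> simple_fun s ->
  simple_integral E D s (v + w) = simple_integral E D s v + simple_integral E D s w.
Proof.
move=> mD ss; rewrite !simple_integral_sum// -big_split/=.
by apply: eq_bigr => z _; rewrite linearD scalerDr.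
Qed.

Lemma simple_integralZr s D a v : measurable D -> simple_fun s ->
  simple_integral E D s (a *: v) = a *: simple_integral E D s v.
Proof.
move=> mD ss; rewrite !simple_integral_sum// scaler_sumr.
by apply: eq_bigr => z _; rewrite linearZ/= !scalerA mulrC.
Qed.

(** Values larger than [c] have fibres disjoint from [D] and may be replaced by 0. A sum over some
    of the fibres is again a value of [E], so [scaled_sum_bound] applies with the bound
    [M * rnorm v]. *)
Lemma simple_integral_bound (M : R)
    (EM : forall A : set borelC, measurable A -> forall v, rnorm (E A v) <= M * rnorm v)
    s D v (c : R) :
  measurable D -> simple_fun s -> 0 < c -> (forall l, D l -> rnorm (s l) <= c) ->
  rnorm (simple_integral E D s v) <= 4 * c * (M * rnorm v).
Proof.
move=> mD ss c0 sc; rewrite simple_integral_sum//.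
have -> : \sum_(z <- values s) z *: E (D `&` s @^-1` [set z]) v =
    \sum_(z <- values s) (if rnorm z <= c then z else 0) *: E (D `&` s @^-1` [set z]) v.
  apply: eq_bigr => z _; case: ifPn => // zc.
  have -> : D `&` s @^-1` [set z] = set0.
    by apply/seteqP; split=> // l [/= /sc lc lz]; move: zc; rewrite -lz lc.
  by rewrite spectral_measure0// !scaler0.
apply: scaled_sum_bound => //.
  by move=> z; case: ifPn => // _; rewrite rnorm0 ltW.
move=> m; have mf z := simple_fun_fiber z ss.
have [mm <-] := spectral_measure_fin v (mask_uniq (values_uniq s) m) mD mf.
by apply: EM; exact: measurableI.
Qed.

End SimpleIntegral.

(** * Uniform approximation of bounded Borel functions by simple ones *)

Section BorelApproximation.
Context {R : realType}.
Local Notation borelC := (g_sigma_algebraType (@open R[i])).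

Lemma rnorm_ReIm (z : R[i]) : rnorm z <= `|complex.Re z| + `|complex.Im z|.
Proof.
rewrite [z in leLHS]complexE; apply: le_trans (rnormD _ _) _.
rewrite rnormM !rnorm_real; have -> : rnorm ('i%C : R[i]) = 1.
  by rewrite rnorm_normc /= expr0n /= add0r expr1n sqrtr1.
by rewrite mul1r.
Qed.

Lemma lipschitz_continuous (k : R[i] -> R) :
  (forall z w, `|k z - k w| <= rnorm (z - w)) -> continuous k.
Proof.
move=> kL z P /nbhs_ballP[e /= e0 eP].
apply: (proj2 (nbhs_rnorm (G := R[i]) z _)); exists e => // w zw.
by apply: eP; exact: le_lt_trans zw.
Qed.

Lemma Re_continuous : continuous (@complex.Re R).
Proof. by apply: lipschitz_continuous => -[a b] [c d]; exact: (normRe_le ((a - c) +i* (b - d))%C). Qed.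

Lemma Im_continuous : continuous (@complex.Im R).
Proof. by apply: lipschitz_continuous => -[a b] [c d]; exact: (normIm_le ((a - c) +i* (b - d))%C). Qed.

Lemma borel_halfspace (k : R[i] -> R) (t : R) : continuous k ->
  measurable ([set z | t <= k z] : set borelC).
Proof.
move=> ck; have -> : [set z | t <= k z] = ~` [set z | k z < t].
  by apply/seteqP; split=> z /=; rewrite leNgt => /negP.
apply: measurableC; apply: borel_open.
exact: (open_comp (fun z _ => ck z) (@open_lt R t)).
Qed.

Lemma simple_fun_indic (A : set borelC) (z : R[i]) : measurable A ->
  simple_fun (fun l => if `[< A l >] then z else 0).
Proof.
move=> mA; apply: simple_funP.
  apply: (@sub_finite_set _ _ [set z; 0]); last exact: finite_set2.
  by move=> _ [l _ <-]; case: ifP; [left|right].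
move=> w.
have -> : (fun l => if `[< A l >] then z else 0) @^-1` [set w] =
    (if z == w then A else set0) `|` (if 0 == w then ~` A else set0).
  apply/seteqP; split=> l /=.
    by case: asboolP => Al <-; rewrite eqxx; [left|right].
  by move=> []; case: eqP => // <- Al; case: asboolP.
by apply: measurableU; case: ifP => // _; exact: measurableC.
Qed.

Lemma simple_fun_sum (s : nat -> R[i] -> R[i]) m :
  (forall a, simple_fun (s a)) -> simple_fun (fun l => \sum_(a < m) s a l).
Proof.
move=> ss; elim: m => [|m IH].
  have -> : (fun l => \sum_(a < 0) s a l) = (fun l => if `[< set0 l >] then 0 else 0).
    by apply/funext => l; rewrite big_ord0 if_same.
  by apply: simple_fun_indic; exact: measurable0.
have -> : (fun l => \sum_(a < m.+1) s a l) = (fun l => \sum_(a < m) s a l) \+ s m.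
  by apply/funext => l; rewrite big_ord_recr.
exact: simple_funD.
Qed.

(** For [x] nonnegative the sum is its integer part capped at [m], written with indicators so that
    composing with a Borel function gives a simple function. The first clause only carries the
    induction. *)
Lemma count_floor (x : R) m :
  (m%:R <= x -> \sum_(a < m) (if a.+1%:R <= x then 1 else 0 : R) = m%:R) /\
  (0 <= x <= m%:R ->
    \sum_(a < m) (if a.+1%:R <= x then 1 else 0 : R) <= x <=
    \sum_(a < m) (if a.+1%:R <= x then 1 else 0 : R) + 1).
Proof.
elim: m => [|m [IH1 IH2]]; rewrite ?big_ord0 ?big_ord_recr/=.
  by split=> // /andP[x0 x1]; rewrite x0 add0r (le_trans x1)// ler01.
split=> [xm|/andP[x0 xm]].
  by rewrite xm IH1 ?natr1// (le_trans _ xm)// ler_nat.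
have [xm'|xm'] := leP m.+1%:R x.
  rewrite IH1; last by rewrite (le_trans _ xm')// ler_nat.
  by rewrite natr1 xm'/= (le_trans xm)// lerDl.
have [mx|mx] := leP m%:R x.
  by rewrite IH1// addr0 mx/= natr1.
by rewrite addr0; apply: IH2; rewrite x0 ltW.
Qed.

(* The real part of p, shifted by c and scaled by n + 1, is rounded down by
   counting the positive integers below it; likewise for the imaginary part. *)
Lemma bounded_borel_approx (D : set borelC) (p : R[i] -> R[i]) (c : R) :
  measurable D -> measurable_fun D (p : borelC -> borelC) ->
  (forall l, D l -> rnorm (p l) <= c) ->
  exists s : nat -> R[i] -> R[i], (forall n, simple_fun (s n)) /\
    forall n l, D l -> rnorm (p l - s n l) <= 2 / n.+1%:R.
Proof.
move=> mD mp pc.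
pose A n (k : R[i] -> R) a : set borelC :=
  D `&` p @^-1` [set z | a.+1%:R / n.+1%:R - c <= k z].
have mA n k a : continuous k -> measurable (A n k a).
  by move=> ck; exact: (mp mD _ (borel_halfspace _ ck)).
(* The shifted and scaled parts of [p] lie between 0 and [2 * c * n.+1], so counting up to this
   bound misses no integer. *)
pose m n := Num.bound (2 * `|c| * n.+1%:R).
pose S n k z l := \sum_(a < m n) (if `[< A n k a l >] then z else 0 : R[i]).
have sS n k z : continuous k -> simple_fun (S n k z).
  by move=> ck; apply: (@simple_fun_sum (fun a l => if `[< A n k a l >] then z else 0)) => a; apply: simple_fun_indic; exact: mA.
(* This constant undoes the shift by [c] in both components. *)
pose z0 : R[i] := (((- c)%:C)%C + 'i%C * ((- c)%:C)%C).
pose s n : R[i] -> R[i] :=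
  ((fun l => if `[< setT l >] then z0 else 0) \+
   (S n (@complex.Re R) ((n.+1%:R^-1)%:C)%C)) \+
   (fun l => 'i%C * S n (@complex.Im R) ((n.+1%:R^-1)%:C)%C l).
have ss n : simple_fun (s n).
  have s0 : simple_fun (fun l => if `[< setT l >] then z0 else 0).
    by apply: simple_fun_indic; exact: measurableT.
  apply: simple_funD; first exact: (simple_funD s0 (sS _ _ _ Re_continuous)).
  exact: (simple_funZ _ (sS _ _ _ Im_continuous)).
exists s; split=> // n l Dl.
have n0 : 0 < n.+1%:R :> R by rewrite ltr0n.
have SE k : S n k ((n.+1%:R^-1)%:C)%C l =
    (((\sum_(a < m n) (if a.+1%:R <= n.+1%:R * (k (p l) + c) then 1 else 0 : R)) / n.+1%:R)%:C)%C.
  rewrite mulr_suml rmorph_sum/=; apply: eq_bigr => a _.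
  have -> : `[< A n k a l >] = (a.+1%:R <= n.+1%:R * (k (p l) + c)).
    rewrite -ler_pdivrMl// mulrC -lerBlDr; apply/asboolP/idP => [[]//|h].
    by split.
  by case: ifP; rewrite ?mul1r ?mul0r.
have err k : `|k (p l)| <= c ->
    `|k (p l) - (- c + (\sum_(a < m n) (if a.+1%:R <= n.+1%:R * (k (p l) + c) then 1 else 0 : R)) / n.+1%:R)|
    <= n.+1%:R^-1.
  rewrite ler_norml => /andP[k1 k2].
  have c0 : 0 <= c by lra.
  have xm : 0 <= n.+1%:R * (k (p l) + c) <= (m n)%:R.
    apply/andP; split; first by apply: mulr_ge0; [exact: ltW|lra].
    apply: le_trans (ltW (archi_boundP _)); last by rewrite !mulr_ge0// ltW.
    by rewrite (mulrC _ n.+1%:R) ler_pM2l// ger0_norm//; lra.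
  have [_ /(_ xm)] := count_floor (n.+1%:R * (k (p l) + c)) (m n).
  set T := \sum_(_ < _) _ => /andP[h1 h2].
  have -> : k (p l) - (- c + T / n.+1%:R) = (n.+1%:R * (k (p l) + c) - T) / n.+1%:R.
    by rewrite mulrBl mulrAC divff ?gt_eqF// mul1r opprD opprK addrA.
  rewrite normrM normfV (gtr0_norm n0) ler_pdivrMr// mulVf ?gt_eqF//.
  by rewrite ler_norml; lra.
have rp : `|complex.Re (p l)| <= c by apply: le_trans (normRe_le _) (pc _ Dl).
have ip : `|complex.Im (p l)| <= c by apply: le_trans (normIm_le _) (pc _ Dl).
have := lerD (err _ rp) (err _ ip); rewrite -mulr2n -[leRHS]mulr_natl.
apply: le_trans; apply: le_trans (rnorm_ReIm _) _.
rewrite /s/= asboolT// !SE.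
case: (p l) => a b /=.
by rewrite !(mul0r, mul1r, addr0, add0r, subr0, mulr0).
Qed.

End BorelApproximation.

(** * Uniform convergence in terms of entourages and real epsilons *)

Lemma uniform_entourageP {U : choiceType} {V : uniformType} (W : set U)
    (u : nat -> U -> V) (h : U -> V) :
  {uniform W, u @ \oo --> h} <->
  forall A : set (V * V), entourage A ->
    \forall n \near \oo, forall t, W t -> A (h t, u n t).
Proof.
split=> [uh A eA|uh P].
  have /uh : nbhs (h : {uniform` W -> V}) [set k | forall y, W y -> A (h y, k y)].
    by apply/uniform_nbhs; exists A; split.
  by [].
move=> /uniform_nbhs[A [eA AP]].
by apply: filterS (uh _ eA) => n nA; apply: AP.
Qed.

Lemma entourage_rnorm {R : realType} {G : normedModType R[i]} (A : set (G * G)) :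
  entourage A <->
  exists2 e : R, 0 < e & forall v w, rnorm (v - w) < e -> A (v, w).
Proof.
split=> [|[e e0 eA]].
  rewrite -entourage_ballE => -[e /= e0 eA].
  have er : e = ((complex.Re e)%:C)%C by apply/esym/RRe_real; rewrite gtr0_real.
  exists (complex.Re e); first by rewrite -ltcR -er.
  by move=> v w vw; apply: eA; rewrite /= -ball_normE /ball_/= er ltr_rnorm.
rewrite -entourage_ballE; exists (e%:C)%C; rewrite /= ?ltcR// => -[v w] /=.
by rewrite -ball_normE /ball_/= ltr_rnorm => /eA.
Qed.

Lemma uniform_rnorm {U : choiceType} {R : realType} {G : normedModType R[i]}
    (W : set U) (u : nat -> U -> G) (h : U -> G) :
  {uniform W, u @ \oo --> h} <->
  forall e : R, 0 < e -> \forall n \near \oo, forall t, W t -> rnorm (h t - u n t) < e.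
Proof.
rewrite uniform_entourageP; split=> [uh e e0|uh A /entourage_rnorm[e e0 eA]].
  apply: (uh [set vw | rnorm (vw.1 - vw.2) < e]).
  by apply/entourage_rnorm; exists e.
by apply: filterS (uh _ e0) => n nA t Wt; apply: eA; exact: nA.
Qed.

(** * Integrals of bounded functions *)

Section BoundedIntegral.
Context {R : realType} {G : completeNormedModType R[i]}.
Local Notation borelC := (g_sigma_algebraType (@open R[i])).
Variables (E : set R[i] -> bounded_op G) (M : R).
Hypotheses (sE : spectral_measure E) (M0 : 0 < M).
Hypothesis EM : forall A : set borelC, measurable A ->
  forall v, rnorm (E A v) <= M * rnorm v.
Implicit Types (D : set borelC) (p q : R[i] -> R[i]) (v w : G).

Local Notation bint := (is_bounded_integral E).

Let Mv_ge0 v : 0 <= M * rnorm v.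
Proof. by rewrite mulr_ge0 ?rnorm_ge0// ltW. Qed.

Lemma uniform_ext D (s : nat -> R[i] -> R[i]) p q : (forall l, D l -> p l = q l) ->
  {uniform D, s @ \oo --> p} -> {uniform D, s @ \oo --> q}.
Proof.
move=> pq /uniform_rnorm sp; apply/uniform_rnorm => e e0.
by apply: filterS (sp _ e0) => n nA l Dl; rewrite -pq//; exact: nA.
Qed.

Lemma bint_ext D p q v w : (forall l, D l -> p l = q l) -> bint D p v w -> bint D q v w.
Proof. by move=> pq [s [ss sp sw]]; exists s; split=> //; exact: uniform_ext sp. Qed.

(** With [s = t] this is the Cauchy property behind existence of the integral; with two different
    sequences it shows that the limit does not depend on the approximation. The added 1 in [c] below
    avoids a division by 0 when [v = 0]. *)
Lemma simple_integral_near D (s t : nat -> R[i] -> R[i]) p v (e : R) :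
  measurable D -> (forall n, simple_fun (s n)) -> (forall n, simple_fun (t n)) ->
  {uniform D, s @ \oo --> p} -> {uniform D, t @ \oo --> p} -> 0 < e ->
  exists N, forall m n, (N <= m)%N -> (N <= n)%N ->
    rnorm (simple_integral E D (s m) v - simple_integral E D (t n) v) < e.
Proof.
move=> mD ss st /uniform_rnorm sp /uniform_rnorm tp e0.
pose c := e / (8 * (M * rnorm v + 1)).
have k0 : 0 < M * rnorm v + 1 by rewrite ltr_wpDl.
have c0 : 0 < c by rewrite divr_gt0// mulr_gt0.
have c2 : 0 < c / 2 by lra.
have [N1 _ N1P] := sp _ c2; have [N2 _ N2P] := tp _ c2.
exists (maxn N1 N2) => m n; rewrite !geq_max => /andP[m1 m2] /andP[n1 n2].
rewrite -(simple_integralB sE (ss m) (st n) v mD).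
have stc l : D l -> rnorm ((s m \- t n) l) <= c.
  move=> Dl; have := N1P m m1 l Dl; have := N2P n n2 l Dl => /=.
  have := rnorm_distD (s m l) (p l) (t n l); rewrite (rnormBC (s m l) (p l)).
  by lra.
apply: le_lt_trans (simple_integral_bound sE EM v mD (simple_funB (ss m) (st n)) c0 stc) _.
have -> : e = 4 * c * (2 * (M * rnorm v + 1)) by rewrite /c; field; rewrite gt_eqF.
rewrite ltr_pM2l; last by apply: mulr_gt0.
by have := Mv_ge0 v; lra.
Qed.

Lemma bint_cvg D p v w s : measurable D -> bint D p v w ->
  (forall n, simple_fun (s n)) -> {uniform D, s @ \oo --> p} ->
  simple_integral E D (s n) v @[n --> \oo] --> w.
Proof.
move=> mD [t [st tp /cvg_rnorm tw]] ss sp; apply/cvg_rnorm => e e0.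
have e2 : 0 < e / 2 by lra.
have [N NP] := simple_integral_near v mD st ss tp sp e2.
have [N' _ N'P] := tw _ e2.
exists (maxn N N') => // n /=; rewrite geq_max => /andP[Nn N'n].
apply: le_lt_trans (rnorm_distD _ (simple_integral E D (t n) v) _) _.
by rewrite (splitr e); apply: ltrD; [exact: N'P|exact: NP].
Qed.

Lemma bint_unique D p v w w' : measurable D -> bint D p v w -> bint D p v w' -> w = w'.
Proof.
move=> mD bw [s [ss sp sw]]; have := bint_cvg mD bw ss sp.
by move=> /cvg_unique; apply => //; exact: norm_hausdorff.
Qed.

Lemma bint_exists D p v (c : R) : measurable D -> measurable_fun D (p : borelC -> borelC) ->
  (forall l, D l -> rnorm (p l) <= c) -> exists w, bint D p v w.
Proof.
move=> mD mp pc; have [s [ss sp]] := bounded_borel_approx mD mp pc.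
have su : {uniform D, s @ \oo --> p}.
  apply/uniform_rnorm => e e0; have e2 : 0 < e / 2 by lra.
  have [N _ NP] := near_infty_natSinv_lt (PosNum e2).
  exists N => // n /NP /= ne l Dl; apply: le_lt_trans (sp n l Dl) _.
  by rewrite mulrC -ltr_pdivlMr.
have [w sw] : exists w : G, simple_integral E D (s n) v @[n --> \oo] --> w.
  by apply: rnorm_cauchy => e e0; exact: (simple_integral_near v mD ss ss su su e0).
by exists w, s.
Qed.

(** Simple functions close to [p] are eventually bounded by [2 * c] on [D], which doubles the
    constant 4 of [simple_integral_bound]. *)
Lemma bint_bound D p v w (c : R) : measurable D -> bint D p v w -> 0 < c ->
  (forall l, D l -> rnorm (p l) <= c) -> rnorm w <= 8 * c * (M * rnorm v).
Proof.
move=> mD [s [ss /uniform_rnorm sp sw]] c0 pc.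
apply: (rnorm_lim_le sw); apply: filterS (sp _ c0) => n nc.
have -> : 8 * c = 4 * (2 * c) by ring.
apply: (simple_integral_bound sE EM) => //; first by rewrite mulr_gt0.
move=> l Dl; have := nc l Dl; have := pc l Dl; have := rnorm_distD (s n l) (p l) 0.
by rewrite !subr0 (rnormBC (s n l)); lra.
Qed.

Lemma bintD D p q v w w' : measurable D -> bint D p v w -> bint D q v w' ->
  bint D (p \+ q) v (w + w').
Proof.
move=> mD [s [ss /uniform_rnorm sp sw]] [t [st /uniform_rnorm tq tw]].
exists (fun n => s n \+ t n); split.
- by move=> n; exact: simple_funD.
- apply/uniform_rnorm => e e0; have e2 : 0 < e / 2 by lra.
  apply: filterS2 (sp _ e2) (tq _ e2) => n h1 h2 l Dl /=.
  have -> : p l + q l - (s n l + t n l) = (p l - s n l) + (q l - t n l) by ring.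
  by apply: le_lt_trans (rnormD _ _) _; have := h1 l Dl; have := h2 l Dl; lra.
under eq_fun do rewrite simple_integralD//.
exact: cvgD.
Qed.

Lemma bintZ D p v w (a : R[i]) : measurable D -> bint D p v w ->
  bint D (fun l => a * p l) v (a *: w).
Proof.
move=> mD [s [ss /uniform_rnorm sp sw]].
exists (fun n l => a * s n l); split.
- by move=> n; exact: simple_funZ.
- apply/uniform_rnorm => e e0.
  have a0 : 0 < rnorm a + 1 by have := rnorm_ge0 a; lra.
  have e2 : 0 < e / (rnorm a + 1) by rewrite divr_gt0.
  apply: filterS (sp _ e2) => n h l Dl /=.
  rewrite -mulrBr rnormM; have := h l Dl; rewrite ltr_pdivlMr// => h1.
  by apply: le_lt_trans h1; rewrite mulrC ler_wpM2l ?rnorm_ge0// lerDl.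
under eq_fun do rewrite simple_integralZ//.
by apply: cvgZr.
Qed.

Lemma bintB D p q v w w' : measurable D -> bint D p v w -> bint D q v w' ->
  bint D (p \- q) v (w - w').
Proof.
move=> mD bp /(bintZ (-1) mD) bq.
by have := bintD mD bp bq; rewrite scaleN1r; apply: bint_ext => l _ /=; rewrite mulN1r.
Qed.

Lemma bintDr D p v v' w w' : measurable D -> bint D p v w -> bint D p v' w' ->
  bint D p (v + v') (w + w').
Proof.
move=> mD [s [ss sp sw]] bw'; exists s; split=> //.
under eq_fun do rewrite simple_integralDr//.
by apply: cvgD => //; exact: bint_cvg sp.
Qed.

Lemma bintZr D p v w a : measurable D -> bint D p v w -> bint D p (a *: v) (a *: w).
Proof.
move=> mD [s [ss sp sw]]; exists s; split=> //.
under eq_fun do rewrite simple_integralZr//.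
exact: cvgZr.
Qed.

Lemma bintBr D p v v' w w' : measurable D -> bint D p v w -> bint D p v' w' ->
  bint D p (v - v') (w - w').
Proof.
move=> mD b /(bintZr (-1) mD) b'; rewrite -!(scaleN1r v') -(scaleN1r w').
exact: bintDr.
Qed.

Lemma bint_bounded D p v w : bint D p v w ->
  exists2 c : R, 0 < c & forall l, D l -> rnorm (p l) <= c.
Proof.
move=> [s [ss /uniform_rnorm sp _]].
have [N _ /(_ N (leqnn N)) NP] := sp _ ltr01.
pose c := \sum_(z <- values (s N)) rnorm z.
have c0 : 0 <= c by rewrite sumr_ge0// => z _; exact: rnorm_ge0.
exists (c + 1); first by lra.
move=> l Dl; have := NP l Dl; have := rnorm_distD (p l) (s N l) 0; rewrite !subr0.
suff : rnorm (s N l) <= c by lra.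
rewrite /c (big_rem (s N l)) ?mem_values//= lerDl.
by rewrite sumr_ge0// => z _; exact: rnorm_ge0.
Qed.

(** Passage to the limit in [simple_integralM]. Both functions are bounded because they are uniform
    limits of simple ones, so the products converge uniformly too. *)
Lemma bint_mul D D' p q v w w' : measurable D -> measurable D' ->
  bint D' q v w' -> bint D p w' w -> bint (D `&` D') (p \* q) v w.
Proof.
move=> mD mD' bq bp; have [cq cq0 qc] := bint_bounded bq.
have [cp cp0 pc] := bint_bounded bp.
move: bq bp => [t [st /uniform_rnorm tq tw]] [s [ss /uniform_rnorm sp sw]].
exists (fun n => s n \* t n); split.
- by move=> n; exact: simple_funM.
- apply/uniform_rnorm => e e0.
  (* The first entry keeps [s n] below [2 * cp]; the second makes [d * cq + 2 * cp * d], the error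
     of the product, at most [e / 2]. *)
  pose d := Num.min cp (e / (2 * (2 * cp + cq))).
  have k0 : 0 < 2 * cp + cq by lra.
  have d0 : 0 < d by rewrite lt_min cp0 divr_gt0// mulr_gt0.
  apply: filterS2 (sp _ d0) (tq _ d0) => n h1 h2 l [Dl D'l] /=.
  have -> : p l * q l - s n l * t n l = (p l - s n l) * q l + s n l * (q l - t n l).
    by ring.
  apply: le_lt_trans (rnormD _ _) _; rewrite !rnormM.
  have {}h1 := ltW (h1 l Dl); have {}h2 := ltW (h2 l D'l).
  have dc : d <= cp by rewrite ge_min lexx.
  have de : d * (2 * cp + cq) <= e / 2.
    rewrite -ler_pdivlMr// (_ : e / 2 / _ = e / (2 * (2 * cp + cq))).
      by rewrite ge_min lexx orbT.
    by rewrite invfM mulrA.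
  have sc : rnorm (s n l) <= 2 * cp.
    have := rnorm_distD (s n l) (p l) 0; rewrite !subr0 (rnormBC (s n l)).
    by have := pc l Dl; lra.
  have := ler_pM (rnorm_ge0 _) (rnorm_ge0 _) h1 (qc l D'l).
  have := ler_pM (rnorm_ge0 _) (rnorm_ge0 _) sc h2.
  lra.
under eq_fun do rewrite simple_integralM//.
apply/cvg_rnorm => e e0; have e2 : 0 < e / 2 by lra.
move/cvg_rnorm : sw => /(_ _ e2); move/cvg_rnorm : tw.
pose k := 16 * cp * M.
have k0 : 0 < k by rewrite !mulr_gt0.
move=> /(_ _ (divr_gt0 e2 k0)) tw sw.
apply: filterS3 (sp _ cp0) tw sw => n h0 h1 h2.
apply: le_lt_trans (rnorm_distD _ (simple_integral E D (s n) w') _) _.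
set x := simple_integral E D' (t n) v in h1 *.
have -> : simple_integral E D (s n) w' - simple_integral E D (s n) x =
    simple_integral E D (s n) (w' - x).
  rewrite -scaleN1r -simple_integralZr// -simple_integralDr//.
  by rewrite scaleN1r.
have h3 : rnorm (simple_integral E D (s n) (w' - x)) <= 4 * (2 * cp) * (M * rnorm (w' - x)).
  apply: (simple_integral_bound sE EM) => //; first by rewrite mulr_gt0.
  move=> l Dl; have := h0 l Dl; have := pc l Dl; have := rnorm_distD (s n l) (p l) 0.
  by rewrite !subr0 (rnormBC (s n l)); lra.
have h4 : 4 * (2 * cp) * (M * rnorm (w' - x)) <= e / 2 * (1 / 2).
  have -> : 4 * (2 * cp) * (M * rnorm (w' - x)) = rnorm (w' - x) * k * (1 / 2).
    by rewrite /k; field.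
  by rewrite ler_pM2r// -ler_pdivlMr// ltW.
by lra.
Qed.

Lemma bint1 D v : measurable D -> bint D (fun=> 1) v (E D v).
Proof.
move=> mD; exists (fun=> fun=> 1); split.
- move=> n; have := @simple_fun_indic R setT 1 (@measurableT _ borelC).
  by congr simple_fun; apply/funext => l; rewrite asboolT.
- by apply/uniform_rnorm => e e0; near=> n => l _; rewrite subrr rnorm0.
have s1 : simple_fun (fun=> 1 : R[i]).
  have := @simple_fun_indic R setT 1 (@measurableT _ borelC).
  by congr simple_fun; apply/funext => l; rewrite asboolT.
apply: cvg_near_cst; near=> n.
rewrite (simple_integral_refine sE v (u := fun=> tt) (r := [:: tt]) (h := fun=> 1))//.
- rewrite big_seq1 scale1r; congr (E _ _); rewrite -[RHS]setIT; congr (_ `&` _).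
  by apply/seteqP; split.

move=> [].
have -> : (fun=> tt) @^-1` [set tt] = setT :> set borelC by apply/seteqP; split.
exact: measurableT.
Unshelve. all: by end_near.
Qed.

Lemma bint_restrict D (A : set borelC) p v w : measurable D -> measurable A ->
  bint D p (E A v) w -> bint (D `&` A) p v w.
Proof.
move=> mD mA bp; have := bint_mul mD mA (bint1 v mA) bp.
by apply: bint_ext => l _ /=; rewrite mulr1.
Qed.

(** The integral over [D] exists since [p] is bounded there, and restricting it to [A] changes
    nothing because [E A] is the identity; uniqueness over the intersection concludes. *)
Lemma bint_sub D (A : set borelC) p v w : measurable D -> measurable A -> (forall v, E A v = v) ->
  measurable_fun D (p : borelC -> borelC) -> (exists c : R, forall l, D l -> rnorm (p l) <= c) ->
  bint (D `&` A) p v w -> bint D p v w.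
Proof.
move=> mD mA EA mp [c pc] bp; have [w' bw'] := bint_exists v mD mp pc.
have bw : bint (D `&` A) p v w' by apply: bint_restrict => //; rewrite EA.
by rewrite (bint_unique _ bp bw)//; exact: measurableI.
Qed.

End BoundedIntegral.

(** * Functional calculus *)

Section FunctionalCalculus.
Context {R : realType} {G : completeNormedModType R[i]}.
Local Notation borelC := (g_sigma_algebraType (@open R[i])).

Lemma bounded_op_exists (h : G -> G) (c : R) : linear h ->
  (forall v, rnorm (h v) <= c * rnorm v) -> exists T : bounded_op G, T =1 h.
Proof.
move=> hL hc.
pose F : {linear G -> G} := HB.pack h (GRing.isLinear.Build R[i] G G *:%R h hL).
have cF : continuous F.
  move=> v; apply/cvg_rnorm => e e0; apply/nbhs_rnorm.
  have k0 : 0 < `|c| + 1 by have := normr_ge0 c; lra.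
  exists (e / (`|c| + 1)); first by rewrite divr_gt0.
  move=> w; rewrite ltr_pdivlMr// -linearB => vw.
  apply: le_lt_trans (hc _) _; apply: le_lt_trans vw; rewrite mulrC.
  by rewrite ler_wpM2l ?rnorm_ge0//; have := ler_norm c; lra.
by exists (BoundedOp cF).
Qed.

Lemma borel_continuous (U : set R[i]) (p : R[i] -> R[i]) : open U ->
  (forall z, U z -> {for z, continuous p}) ->
  measurable_fun (U : set borelC) (p : borelC -> borelC).
Proof.
move=> oU cp; apply: (@measurability _ _ borelC borelC U p (@open R[i])) => // _ [V oV <-].
apply: borel_open; rewrite openE => z [Uz Vz]; apply: filterI.
  exact: open_nbhs_nbhs.
by apply: (cp z Uz); exact: open_nbhs_nbhs.
Qed.

Lemma borel_rnorm_le (c : R) : measurable ([set z | rnorm z <= c] : set borelC).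
Proof.
have -> : [set z : R[i] | rnorm z <= c] = [set z | - c <= - rnorm z].
  by apply/seteqP; split=> z /=; rewrite lerN2.
apply: borel_halfspace; apply: lipschitz_continuous => z w; rewrite ler_norml.
have := rnorm_distD z w 0; have := rnorm_distD w z 0.
by rewrite !subr0 (rnormBC w); lra.
Qed.

Variables (E : set R[i] -> bounded_op G) (M : R).
Hypotheses (sE : spectral_measure E) (M0 : 0 < M).
Hypothesis EM : forall A : set borelC, measurable A ->
  forall v, rnorm (E A v) <= M * rnorm v.
Implicit Types (D U d : set borelC) (p q : R[i] -> R[i]) (v w : G).

Local Notation bint := (is_bounded_integral E).

Definition essential d := measurable d /\ forall v, E d v = v.

Lemma essentialI d d' : essential d -> essential d' -> essential (d `&` d').
Proof.
move=> [md Ed] [md' Ed']; split; first exact: measurableI.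
exact: spectral_measure_setI.
Qed.

Lemma essential_bigcap (d : nat -> set borelC) : (forall n, essential (d n)) ->
  essential (\bigcap_n d n).
Proof.
move=> ed; split; first by apply: bigcapT_measurable => n; have [] := ed n.
by apply: spectral_measure_bigcap => // n; have [] := ed n.
Qed.

Lemma level_measurable U p (n : nat) : measurable U ->
  measurable_fun U (p : borelC -> borelC) ->
  measurable ([set l | U l /\ `|p l| <= n%:R] : set borelC).
Proof.
move=> mU mp; have := mp mU _ (borel_rnorm_le n%:R).
congr measurable; apply/seteqP.
have nE z : (`|z : R[i]| <= n%:R) = (rnorm z <= n%:R).
  by rewrite rnormE -[n%:R in LHS](rmorph_nat (@real_complex_def R (Phant R))) lecR.
by split=> l /= [Ul]; rewrite nE.
Qed.

(** Once [n] exceeds [c], the level set of [p] contains all of [U] that lies in [d], so the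
    truncated integrals are stationary. *)
Lemma is_integral_near U d p v w (I : nat -> G) (c : R) : measurable U ->
  measurable_fun U (p : borelC -> borelC) -> essential d ->
  (forall l, U l -> d l -> rnorm (p l) <= c) -> bint (U `&` d) p v w ->
  (forall n, bint [set l | U l /\ `|p l| <= n%:R] p v (I n)) -> I @ \oo --> w.
Proof.
move=> mU mp [md Ed] pc bw bI; apply: cvg_near_cst.
exists (Num.bound `|c|) => // n /= cn.
have nE z : (`|z : R[i]| <= n%:R) = (rnorm z <= n%:R).
  by rewrite rnormE -[n%:R in LHS](rmorph_nat (@real_complex_def R (Phant R))) lecR.
have cn' : c <= n%:R.
  apply: le_trans (ler_norm c) _; apply: le_trans (ltW (archi_boundP (normr_ge0 c))) _.
  by rewrite ler_nat.
have mL := level_measurable n mU mp.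
apply: (bint_unique sE M0 EM mL (bI n)).
apply: (bint_sub sE M0 EM mL md Ed).
- by apply: measurable_funS mp => // l [].
- by exists n%:R => l [_]; rewrite nE.
suff -> : [set l | U l /\ `|p l| <= n%:R] `&` d = U `&` d by [].
apply/seteqP; split=> l; first by move=> [[Ul _] dl].
by move=> [Ul dl]; split=> //; split=> //; rewrite nE (le_trans (pc _ Ul dl)).
Qed.

(** For essentially bounded [p] the limit of truncations is a single bounded integral, over any
    essential set on which [p] is bounded. The set [d] is left free so that several functions can
    later be integrated over the same set. *)
Lemma is_integralP U d p v w (c : R) : measurable U ->
  measurable_fun U (p : borelC -> borelC) -> essential d ->
  (forall l, U l -> d l -> rnorm (p l) <= c) ->
  is_integral E U p v w <-> bint (U `&` d) p v w.
Proof.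
move=> mU mp ed pc; have [md Ed] := ed.
have nE n z : (`|z : R[i]| <= n%:R) = (rnorm z <= n%:R).
  by rewrite rnormE -[n%:R in LHS](rmorph_nat (@real_complex_def R (Phant R))) lecR.
split=> [[I [bI Iw]]|bw].
  have mUd : measurable (U `&` d) by exact: measurableI.
  have [w' bw'] : exists w', bint (U `&` d) p v w'.
    apply: (bint_exists sE M0 EM v (c := c) mUd); first by apply: measurable_funS mp => // l [].
    by move=> l [Ul dl]; exact: pc.
  suff -> : w = w' by [].
  apply: (cvg_unique _ Iw); first exact: norm_hausdorff.
  exact: is_integral_near mp ed pc bw' bI.
have exI n : exists w', bint [set l | U l /\ `|p l| <= n%:R] p v w'.
  apply: (bint_exists sE M0 EM v (c := n%:R)).
  - exact: level_measurable.
  - by apply: measurable_funS mp => // l [].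
  by move=> l [_]; rewrite nE.
have [I bI] := choice exI.
by exists I; split=> //; exact: is_integral_near mp ed pc bw bI.
Qed.

(** The integrals depend linearly on [v] and are bounded by a multiple of its norm, so they define
    an element of B(G) and the default value of [fun_calc] is not taken. *)
Lemma fun_calcP U d p (c : R) : measurable U ->
  measurable_fun U (p : borelC -> borelC) -> essential d ->
  (forall l, U l -> d l -> rnorm (p l) <= c) ->
  forall v, bint (U `&` d) p v (fun_calc E U p v).
Proof.
move=> mU mp ed pc; have [md _] := ed.
have mUd : measurable (U `&` d) by exact: measurableI.
suff [T TP] : exists T : bounded_op G, forall v, bint (U `&` d) p v (T v).
  move=> v; apply/(is_integralP v _ mU mp ed pc); move: v.
  apply: (@xgetPex _ (bop_zero G) [set T : bounded_op G | forall v, is_integral E U p v (T v)]).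
  by exists T => v /=; apply/(is_integralP v _ mU mp ed pc).
have exw v : exists w, bint (U `&` d) p v w.
  apply: (bint_exists sE M0 EM v (c := c)) => //; first by apply: measurable_funS mp => // l [].
  by move=> l [Ul dl]; exact: pc.
have [h hP] := choice exw.
have hL : linear h.
  move=> a v w; apply: (bint_unique sE M0 EM mUd (hP _)).
  by apply: (bintDr sE M0 EM) => //; exact: bintZr.
have [v|T Th] := @bounded_op_exists h (8 * (`|c| + 1) * M) hL.
  rewrite -[leRHS]mulrA; apply: (bint_bound sE EM mUd (hP v)).
    by rewrite ltr_wpDl.
  move=> l [Ul dl]; apply: le_trans (pc l Ul dl) _.
  by have := ler_norm c; lra.
by exists T => v; rewrite Th.
Qed.

Lemma bint_continuous D p (v : nat -> G) (w : nat -> G) v' w' : measurable D ->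
  (forall n, bint D p (v n) (w n)) -> bint D p v' w' -> v @ \oo --> v' -> w @ \oo --> w'.
Proof.
move=> mD bn b' /cvg_rnorm vv'; apply/cvg_rnorm => e e0.
have [c c0 pc] := bint_bounded b'.
have k0 : 0 < 8 * c * M by rewrite !mulr_gt0.
apply: filterS (vv' _ (divr_gt0 e0 k0)) => n.
rewrite ltr_pdivlMr// mulrC; apply: le_lt_trans; rewrite -[leRHS]mulrA.
apply: (bint_bound sE EM mD _ c0 pc).
exact: (bintBr sE M0 EM).
Qed.

(** The disk is written exactly as the truncation set in [is_integral E setT id], which defines the
    operator. *)
Lemma cvg_spectral_disk v :
  E [set l | setT l /\ `|id l| <= n%:R] v @[n --> \oo] --> v.
Proof.
pose d (n : nat) : set borelC := [set l | setT l /\ `|id l| <= n%:R].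
have md n : measurable (d n).
  by apply: level_measurable => //; exact: measurable_id.
have nd : nondecreasing_seq d.
  move=> m n mn; apply/subsetPset => l [_ lm]; split=> //.
  by rewrite (le_trans lm)// ler_nat.
have := @spectral_measure_cvg _ _ _ sE d v md nd.
suff -> : \bigcup_n d n = setT by rewrite (spectral_measureT sE).
apply/seteqP; split=> // l _; exists (Num.bound (rnorm (l : R[i]))) => //; split=> //=.
rewrite rnormE -(rmorph_nat (@real_complex_def R (Phant R))) lecR.
by rewrite ltW// archi_boundP// rnorm_ge0.
Qed.

Variable A : unbounded_op G.
Hypothesis sA : scalar_type A E.

(** This is r(R)(Ru) = (r id)(R)u. Replace [A u] by the integrals of the identity over the disks
    [d n], and [val u] by [E (d n) (val u)]: both sides become the integral of [r l * l] over the
    part of [D] in [d n]. Then let n tend to infinity, by continuity of bounded integrals in the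
    vector. *)
Lemma bint_dom D r (u : Dom A) w w' :
  measurable D -> (forall v, exists x, bint D r v x) ->
  (forall v, exists x, bint D (fun l => r l * l) v x) ->
  bint D r (A u) w -> bint D (fun l => r l * l) (val u) w' -> w = w'.
Proof.
move=> mD er eri bw bw'.
have [I [bI IA]] : is_integral E setT id (val u) (A u).
  by apply/sA.2; exists u.
pose d (n : nat) : set borelC := [set l | setT l /\ `|id l| <= n%:R].
have md n : measurable (d n).
  by apply: level_measurable => //; exact: measurable_id.
have [x xP] := choice (fun n => er (I n)).
have [y yP] := choice (fun n => eri (E (d n) (val u))).
have xw : x @ \oo --> w by exact: bint_continuous xP bw IA.
have yw : y @ \oo --> w'.
  by apply: bint_continuous yP bw' _ => //; exact: cvg_spectral_disk.
suff xy : x = y.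
  by apply: (cvg_unique _ xw); [exact: norm_hausdorff|rewrite xy].
apply/funext => n; have mDd : measurable (D `&` d n) by exact: measurableI.
have b1 := bint_restrict sE M0 EM mD (md n) (yP n).
have b2 := bint_mul sE M0 EM mD (md n) (bI n) (xP n).
exact: (bint_unique sE M0 EM mDd b2 b1).
Qed.

(* The quotient q = (P' - P) / l is an admissible integrand and
   P' (R) v - P (R) v = q(R) (R v). *)
Lemma fun_calc_increment (U : set R[i]) d (P P' c : R[i] -> R[i]) (k e b : R)
    (u : Dom A) :
  open U -> (forall z, U z -> {for z, continuous P}) ->
  (forall z, U z -> {for z, continuous P'}) ->
  measurable_fun (U : set borelC) (c : borelC -> borelC) -> essential d -> 0 < e ->
  (forall l, U l -> d l -> rnorm (P l) <= b /\ rnorm (P' l) <= b /\ rnorm (c l) <= b) ->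
  (forall l, U l -> d l ->
     rnorm (P' l - P l - (k%:C)%C * l * c l) <= e * rnorm l) ->
  rnorm (fun_calc E U P' (val u) - fun_calc E U P (val u) -
         (k%:C)%C *: fun_calc E U c (A u)) <= 8 * e * (M * rnorm (A u)).
Proof.
move=> oU cP cP' mc ed e0 bb est; have [md _] := ed.
have mU : measurable (U : set borelC) := borel_open oU.
pose D : set borelC := (U : set borelC) `&` d.
have mD : measurable D by exact: measurableI.
have bP := fun_calcP mU (borel_continuous oU cP) ed (fun l Ul dl => (bb l Ul dl).1).
have bP' := fun_calcP mU (borel_continuous oU cP') ed (fun l Ul dl => (bb l Ul dl).2.1).
have bc := fun_calcP mU mc ed (fun l Ul dl => (bb l Ul dl).2.2).
(* The value at 0 makes [q] agree there with [k * c]. The identity [qid] survives at 0, because the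
   hypothesis for [l = 0] forces [P' 0 = P 0]. *)
pose q l : R[i] := if l == 0 then (k%:C)%C * c 0 else (P' l - P l) / l.
have qid l : D l -> (P' \- P) l = q l * l.
  move=> [Ul dl]; rewrite /q/=; case: eqVneq => [l0|l0]; last by rewrite divfK.
  have := est l Ul dl; rewrite l0 !(mulr0, mul0r) rnorm0 subr0 mulr0 => h.
  by apply: rnorm_eq0; apply/eqP; rewrite eq_le h rnorm_ge0.
have qe l : D l -> rnorm ((q \- (fun l => (k%:C)%C * c l)) l) <= e.
  move=> [Ul dl]; rewrite /q/=; case: eqVneq => [->|l0].
    by rewrite subrr rnorm0 ltW.
  have n0 : 0 < rnorm l.
    rewrite lt_neqAle rnorm_ge0 andbT eq_sym; apply: contra l0 => /eqP l0.
    by apply/eqP/rnorm_eq0.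
  have -> : (P' l - P l) / l - (k%:C)%C * c l = (P' l - P l - (k%:C)%C * l * c l) / l.
    by field.
  by rewrite rnormM rnormV ler_pdivrMr//; exact: est.
(* Off 0 the quotient is continuous on an open set; the point 0 is glued back as a separate Borel
   piece. *)
have mq : measurable_fun D (q : borelC -> borelC).
  have oU0 : open (U `&` ~` [set 0]).
    apply: openI => //; rewrite openC; apply: (@compact_closed R[i]); last exact: compact_set1.
    exact: (@norm_hausdorff _ R[i]).
  have mq0 : measurable_fun ((U `&` ~` [set 0]) : set borelC) (q : borelC -> borelC).
    apply: borel_continuous => // z [Uz z0].
    have zn0 : z != 0 by apply/eqP.
    have qE : \forall l \near (z : R[i]), (P' l - P l) / l = q l.
      have [r r0 rP] := (nbhs_rnorm (G := R[i]) z (U `&` ~` [set 0])).1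
        (open_nbhs_nbhs (conj oU0 (conj Uz z0))).
      apply: (proj2 (nbhs_rnorm (G := R[i]) z _)); exists r => // w /rP[_ /eqP w0].
      by rewrite /q (negPf w0).
    have qc : (fun l => (P' l - P l) / l) @ (z : R[i]) --> (P' z - P z) / z.
      apply: (@cvgM R[i] R[i] (nbhs z) _ (P' \- P) (fun l => l^-1)).
        by apply: (@cvgB R[i] R[i] R[i] (nbhs z) _ P' P); [exact: cP'|exact: cP].
      exact: (@cvgV R[i] R[i] (nbhs z) _ id).
    rewrite /prop_for /continuous_at {2}/q (negPf zn0).
    exact: cvg_trans (near_eq_cvg qE) qc.
  have mq1 : measurable_fun ([set 0] : set borelC) (q : borelC -> borelC).
    exact: measurable_fun_set1.
  apply: (@measurable_funS _ _ _ _ (((U `&` ~` [set 0]) : set borelC) `|` [set 0])).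
  - by apply: measurableU; [exact: borel_open|exact: borel_set1].
  - move=> l [Ul dl]; have [->|l0] := eqVneq l 0; [by right|left; split=> //].
    exact/eqP.
  by apply/measurable_funU => //; [exact: borel_open|exact: borel_set1].
have bq v : exists x, bint D q v x.
  apply: (bint_exists sE M0 EM v (c := e + `|k| * b) mD mq) => l Dl.
  have := qe l Dl; have := rnorm_distD (q l) ((k%:C)%C * c l) 0; rewrite !subr0/=.
  have := (bb l Dl.1 Dl.2).2.2; rewrite rnormM rnorm_real => h.
  have := ler_wpM2l (normr_ge0 k) h; lra.
have bPP v : bint D (fun l => q l * l) v (fun_calc E U P' v - fun_calc E U P v).
  by apply: bint_ext qid _; exact: (bintB sE).
have [w bw] := bq (A u).
have <- : w = fun_calc E U P' (val u) - fun_calc E U P (val u).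
  by apply: bint_dom bw (bPP _) => // v; exists (fun_calc E U P' v - fun_calc E U P v).
apply: (bint_bound sE EM mD _ e0 qe).
by apply: (bintB sE) => //; exact: (bintZ sE).
Qed.

Lemma Linf_norm_lt U p (e : R) : (Linf_norm E U p < e%:E)%E ->
  exists2 d, essential d & forall l, U l -> d l -> rnorm (p l) <= e.
Proof.
rewrite /Linf_norm /ess_norm => /ereal_inf_lt[_ [d [md Ed] <-] se].
exists d => // l Ul dl; rewrite -lee_fin; apply: le_trans (ltW se).
apply: ereal_sup_ubound; right; exists l => //=.
by rewrite indicE mem_set// mulr1.
Qed.

Lemma Linf_norm_fin U p : (Linf_norm E U p < +oo)%E ->
  exists2 d, essential d & exists c, forall l, U l -> d l -> rnorm (p l) <= c.
Proof.
move=> pf; suff [c pc] : exists c : R, (Linf_norm E U p < c%:E)%E.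
  by have [d ed dP] := Linf_norm_lt pc; exists d => //; exists c.
case: (Linf_norm E U p) pf => [r _| |_] //.
  by exists (r + 1); rewrite lte_fin ltrDl.
by exists 0; rewrite ltNyr.
Qed.

End FunctionalCalculus.

(** * Analytic functions and the mean value inequality *)

Section QuadraticDifferentiability.
Context {R : realType}.
Implicit Types (U : set R[i]) (f d : R[i] -> R[i]).

Lemma ReB (z w : R[i]) : complex.Re (z - w) = complex.Re z - complex.Re w.
Proof. by case: z; case: w. Qed.

Lemma ImB (z w : R[i]) : complex.Im (z - w) = complex.Im z - complex.Im w.
Proof. by case: z; case: w. Qed.

Lemma ReMr (t : R) (z : R[i]) : complex.Re ((t%:C)%C * z) = t * complex.Re z.
Proof. by case: z => a b /=; rewrite mul0r subr0. Qed.

Lemma complex_cauchy (u : nat -> R[i]) :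
  (forall e : R, 0 < e -> exists N, forall m n, (N <= m)%N -> (N <= n)%N ->
     rnorm (u m - u n) < e) ->
  exists l : R[i], forall e : R, 0 < e -> \forall n \near \oo, rnorm (l - u n) < e.
Proof.
move=> uC.
have rC (k : R[i] -> R) : (forall z w, `|k z - k w| <= rnorm (z - w)) ->
    exists l : R, (k \o u) @ \oo --> l.
  move=> kL; suff : cvg ((k \o u) @ \oo) by move=> kc; exists (lim ((k \o u) @ \oo)).
  apply: cauchy_cvg; apply: cauchy_exP => e e0.
  have [N NP] := uC _ e0; exists (k (u N)); exists N => // n /= Nn.
  rewrite -ball_normE /ball_/=; apply: le_lt_trans (kL _ _) _; exact: NP.
have [|a /cvgrPdist_lt ua] := rC (@complex.Re R).
  by move=> z w; rewrite -ReB normRe_le.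
have [|b /cvgrPdist_lt ub] := rC (@complex.Im R).
  by move=> z w; rewrite -ImB normIm_le.
exists (a +i* b)%C => e e0; have e2 : 0 < e / 2 by lra.
apply: filterS2 (ua _ e2) (ub _ e2) => n /= h1 h2.
by apply: le_lt_trans (rnorm_ReIm _) _; rewrite ReB ImB /=; lra.
Qed.

(* A locally uniform form of complex differentiability, with derivative d, that
   is stable under differences and symmetric enough to make d continuous. *)
Definition quad_diff U f d := forall z0, U z0 -> exists M r : R,
  [/\ 0 <= M, 0 < r & forall z w, rnorm (z - z0) < r -> rnorm (w - z0) < r ->
    rnorm (f z - f w - d w * (z - w)) <= M * rnorm (z - w) ^+ 2].

Lemma quad_diffB U f d f' d' : quad_diff U f d -> quad_diff U f' d' ->
  quad_diff U (f \- f') (d \- d').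
Proof.
move=> qf qf' z0 Uz0; have [M [r [M0 r0 H]]] := qf _ Uz0.
have [M' [r' [M0' r0' H']]] := qf' _ Uz0.
exists (M + M'), (Num.min r r'); split; [exact: addr_ge0|by rewrite lt_min r0|].
move=> z w; rewrite !lt_min => /andP[zr zr'] /andP[wr wr'].
have -> : (f \- f') z - (f \- f') w - (d \- d') w * (z - w) =
  (f z - f w - d w * (z - w)) - (f' z - f' w - d' w * (z - w)) by rewrite /=; ring.
apply: le_trans (rnormB _ _) _; rewrite mulrDl.
by apply: lerD; [exact: H|exact: H'].
Qed.

(** The expansions about [w] and about [z] have remainders that add up to [(d z - d w) * (z - w)],
    whence the constant [2 * M] after division by the norm of [z - w]. *)
Lemma quad_diff_lipschitz U f d z0 : quad_diff U f d -> U z0 -> exists L r : R,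
  [/\ 0 <= L, 0 < r & forall z w, rnorm (z - z0) < r -> rnorm (w - z0) < r ->
    rnorm (d z - d w) <= L * rnorm (z - w)].
Proof.
move=> qf Uz0; have [M [r [M0 r0 H]]] := qf _ Uz0.
exists (2 * M), r; split=> //; first by rewrite mulr_ge0.
move=> z w zr wr; have [->|zw] := eqVneq z w; first by rewrite !subrr rnorm0 mulr0.
have n0 : 0 < rnorm (z - w).
  rewrite lt_neqAle rnorm_ge0 andbT eq_sym; apply: contra zw => /eqP/rnorm_eq0/eqP.
  by rewrite subr_eq0.
rewrite -(ler_pM2r n0) -rnormM.
have -> : (d z - d w) * (z - w) = (f z - f w - d w * (z - w)) + (f w - f z - d z * (w - z)).
  by ring.
apply: le_trans (rnormD _ _) _.
have := H z w zr wr; have := H w z wr zr; rewrite (rnormBC w z) expr2; lra.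
Qed.

Lemma quad_diff_continuous U f d z0 : quad_diff U f d -> U z0 ->
  {for z0, continuous f}.
Proof.
move=> qf Uz0; have [M [r [M0 r0 H]]] := qf _ Uz0.
apply: (proj2 (@cvg_rnorm _ R[i] _ (nbhs z0) _ f (f z0))) => e e0.
apply: (proj2 (nbhs_rnorm (G := R[i]) z0 _)).
pose k := M * r + rnorm (d z0) + 1.
have k0 : 0 < k by have := mulr_ge0 M0 (ltW r0); have := rnorm_ge0 (d z0); rewrite /k; lra.
exists (Num.min r (e / k)); first by rewrite lt_min r0 divr_gt0.
move=> w; rewrite lt_min => /andP[wr]; rewrite ltr_pdivlMr// => we.
rewrite rnormBC -(subrK (d z0 * (w - z0)) (f w - f z0)).
have wr' : rnorm (w - z0) < r by rewrite rnormBC.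
have := H w z0 wr'; rewrite subrr rnorm0 => /(_ r0) h.
apply: le_lt_trans (rnormD _ _) _; rewrite rnormM.
have h2 := ler_wpM2l (mulr_ge0 M0 (rnorm_ge0 (w - z0))) (ltW wr').
move: h h2 we; rewrite (rnormBC z0) /k expr2.
move: (rnorm_ge0 (w - z0)); nra.
Qed.

Lemma quad_diff_derive1 f (z : R[i]) (c : R[i]) (M r : R) : 0 <= M -> 0 < r ->
  (forall w, rnorm (w - z) < r ->
     rnorm (f w - f z - c * (w - z)) <= M * rnorm (w - z) ^+ 2) ->
  derive1 f z = c.
Proof.
move=> M0 r0 H; apply: cvg_lim; first exact: norm_hausdorff.
apply: (proj2 (@cvg_rnorm _ R[i] _ (0^') _ _ c)) => e e0.
have k0 : 0 < M + 1 by lra.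
apply: (proj2 (nbhs_rnorm (G := R[i]) 0 _)).
exists (Num.min r (e / (M + 1))); first by rewrite lt_min r0 divr_gt0.
move=> h; rewrite add0r rnormN lt_min ltr_pdivlMr// => /andP[hr he] h0.
have := H (h + z); rewrite addrK => /(_ hr) Hh.
have n0 : 0 < rnorm h.
  by rewrite lt_neqAle rnorm_ge0 andbT eq_sym; apply: contra h0 => /eqP/rnorm_eq0/eqP.
rewrite rnormBC -(ltr_pM2l n0) -rnormM.
have -> : h * (h^-1 *: (f (h + z) - f z) - c) = f (h + z) - f z - c * h.
  by rewrite mulrBr -[h^-1 *: _]/(h^-1 * _) mulrA divff// mul1r (mulrC h).
apply: le_lt_trans Hh _; rewrite expr2 mulrCA ltr_pM2l//; lra.
Qed.

(* Apply the real mean value theorem to t |-> Re (w (f (t l) - t l c)) where w is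
   the unit number that makes the increment of f (t l) - t l c nonnegative. *)
Lemma segment_mean_value U f d (l c : R[i]) (s t e : R) : quad_diff U f d -> s <= t ->
  (forall x, s <= x <= t -> U ((x%:C)%C * l)) ->
  (forall x, s <= x <= t -> rnorm (d ((x%:C)%C * l) - c) <= e) ->
  rnorm (f ((t%:C)%C * l) - f ((s%:C)%C * l) - ((t - s)%:C)%C * l * c)
    <= (t - s) * e * rnorm l.
Proof.
move=> qf st Ul de; set z := _ - _ - _.
have [z0|z0] := eqVneq z 0.
  rewrite z0 rnorm0 mulr_ge0 ?rnorm_ge0// mulr_ge0 ?subr_ge0//.
  by apply: le_trans (de s _); rewrite ?rnorm_ge0// lexx.
have n0 : 0 < rnorm z.
  by rewrite lt_neqAle rnorm_ge0 andbT eq_sym; apply: contra z0 => /eqP/rnorm_eq0/eqP.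
pose w : R[i] := ((rnorm z)%:C)%C / z.
have w1 : rnorm w = 1.
  by rewrite rnormM rnormV rnorm_real gtr0_norm// divff// gt_eqF.
pose g (x : R) := complex.Re (w * (f ((x%:C)%C * l) - (x%:C)%C * (l * c))).
pose dg (x : R) := complex.Re (w * (l * (d ((x%:C)%C * l) - c))).
have gd x : s <= x <= t -> is_derive x 1 g (dg x).
  move=> sxt; have [M [r [M0 r0 H]]] := qf _ (Ul x sxt).
  suff gc : (fun h => h^-1 *: (g (h *: 1 + x) - g x)) @ 0^' --> dg x.
    by apply: DeriveDef; [apply/cvg_ex; exists (dg x)|exact: cvg_lim gc].
  have k0 : 0 < rnorm l + 1 by have := rnorm_ge0 l; lra.
  have k0' : 0 < M * rnorm l ^+ 2 + 1.
    by apply: ltr_wpDl => //; rewrite mulr_ge0// exprn_ge0// rnorm_ge0.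
  apply/cvgrPdist_lt => eps eps0; near=> h.
  have h0 : h != 0 by near: h; exact: nbhs_dnbhs_neq.
  have hn : 0 < `|h| by rewrite normr_gt0.
  have hr : `|h| * (rnorm l + 1) < r.
    rewrite -ltr_pdivlMr//; near: h; apply: dnbhs0_lt; exact: divr_gt0.
  have he : `|h| * (M * rnorm l ^+ 2 + 1) < eps.
    rewrite -ltr_pdivlMr//; near: h; apply: dnbhs0_lt; exact: divr_gt0.
  rewrite distrC -(ltr_pM2l hn) -normrM mulrBr [h *: 1]mulr1.
  rewrite -[h^-1 *: _]/(h^-1 * _) mulrA divff// mul1r.
  have -> : g (h + x) - g x - h * dg x = complex.Re (w *
      (f (((h + x)%:C)%C * l) - f ((x%:C)%C * l) - d ((x%:C)%C * l) * ((h%:C)%C * l))).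
    by rewrite /g /dg -ReMr -!ReB rmorphD/=; congr complex.Re; ring.
  apply: le_lt_trans (normRe_le _) _; rewrite rnormM w1 mul1r.
  have := H (((h + x)%:C)%C * l) ((x%:C)%C * l).
  rewrite -mulrBl -rmorphB/= addrK subrr rnorm0 rnormM rnorm_real => /(_ _ r0) Hh.
  have hr' : `|h| * rnorm l < r by apply: le_lt_trans hr; rewrite ler_wpM2l// lerDl.
  apply: le_lt_trans (Hh hr') _.
  have -> : M * (`|h| * rnorm l) ^+ 2 = `|h| * (`|h| * (M * rnorm l ^+ 2)) by ring.
  by rewrite ltr_pM2l//; apply: le_lt_trans he; rewrite ler_wpM2l// lerDl.
have gc : {within `[s, t], continuous g}.
  apply: derivable_within_continuous => x; rewrite in_itv /= => xst.
  by have [] := gd x xst.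
have gd' x : x \in `]s, t[%R -> is_derive x 1 g (dg x).
  by rewrite in_itv/= => /andP[sx xt]; apply: gd; rewrite !ltW.
have [x] := MVT_segment st gd' gc.
rewrite in_itv/= => xst gE.
have -> : rnorm z = g t - g s.
  rewrite /g -ReB; have -> : w * (f ((t%:C)%C * l) - (t%:C)%C * (l * c)) -
      w * (f ((s%:C)%C * l) - (s%:C)%C * (l * c)) = w * z.
    by rewrite /z rmorphB/=; ring.
  by rewrite /w divfK.
rewrite gE mulrC -[leRHS]mulrA ler_wpM2l ?subr_ge0// /dg.
apply: le_trans (ler_norm _) _; apply: le_trans (normRe_le _) _.
by rewrite 2!rnormM w1 mul1r mulrC ler_wpM2r ?rnorm_ge0//; exact: de.
Unshelve. all: by end_near.
Qed.

End QuadraticDifferentiability.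

(** * Quadratic remainder of power series *)

Section PowerSeries.
Context {R : realType}.

(** The factor [rho ^+ 2] on the left avoids the exponent k - 2. The remainder at k + 1 is [x] times
    the remainder at k plus k y^(k-1) (x - y)^2, and k^2 + k <= (k + 1)^2. *)
Lemma power_quad (x y : R[i]) (rho : R) k : rnorm x <= rho -> rnorm y <= rho ->
  rho ^+ 2 * rnorm (x ^+ k - y ^+ k - (y ^+ k.-1 *+ k) * (x - y)) <=
  k%:R ^+ 2 * rho ^+ k * rnorm (x - y) ^+ 2.
Proof.
move=> xr yr; have r0 : 0 <= rho by apply: le_trans yr; exact: rnorm_ge0.
elim: k => [|k IH].
  by rewrite !expr0 mulr0n mul0r subrr subr0 rnorm0 mulr0 mulr1 mulr_ge0 ?exprn_ge0 ?rnorm_ge0.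
have -> : x ^+ k.+1 - y ^+ k.+1 - y ^+ k.+1.-1 *+ k.+1 * (x - y) =
  x * (x ^+ k - y ^+ k - (y ^+ k.-1 *+ k) * (x - y)) + (y ^+ k.-1 *+ k) * (x - y) ^+ 2.
  case: k {IH} => [|k] /=; first by rewrite !expr0 expr1 mulr0n !mul0r; ring.
  rewrite mulrSr (exprS x k.+1) (exprS y k.+1) (exprS y k) -!mulrnAr.
  by move: (y ^+ k *+ k.+1) (y ^+ k) (x ^+ k.+1) => u q p; ring.
set T := _ - _ - _ in IH *; set delta := rnorm (x - y).
have d0 : 0 <= delta ^+ 2 by rewrite exprn_ge0// rnorm_ge0.
have h1 : rho ^+ 2 * rnorm (x * T) <= rho * (k%:R ^+ 2 * rho ^+ k * delta ^+ 2).
  rewrite rnormM mulrCA; apply: ler_pM => //; first exact: rnorm_ge0.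
  by rewrite mulr_ge0 ?rnorm_ge0// exprn_ge0.
have h2 : rho ^+ 2 * rnorm (y ^+ k.-1 *+ k * (x - y) ^+ 2) <=
    k%:R * rho ^+ k.+1 * delta ^+ 2.
  case: k {IH T h1} => [|k]; first by rewrite mulr0n mul0r rnorm0 !(mulr0, mul0r).
  rewrite rnormM rnormX -/delta mulrA ler_wpM2r// -mulr_natl rnormM rnorm_nat mulrCA.
  rewrite ler_wpM2l// rnormX (exprD rho 2 k) ler_wpM2l ?exprn_ge0//.
  by rewrite lerXn2r// ?nnegrE ?rnorm_ge0.
apply: le_trans (ler_wpM2l (exprn_ge0 2 r0) (rnormD _ _)) _.
rewrite mulrDr; apply: le_trans (lerD h1 h2) _.
have -> : rho * (k%:R ^+ 2 * rho ^+ k * delta ^+ 2) + k%:R * rho ^+ k.+1 * delta ^+ 2 =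
    (k%:R ^+ 2 + k%:R) * rho ^+ k.+1 * delta ^+ 2 by rewrite (exprS rho k); ring.
rewrite ler_wpM2r// ler_wpM2r ?exprn_ge0// -(natr1 k).
have : 0 <= k%:R :> R by []. nra.
Qed.

Lemma sum_half_le n : \sum_(0 <= k < n) (1 / 2 : R) ^+ k <= 2.
Proof.
suff -> : \sum_(0 <= k < n) (1 / 2 : R) ^+ k = 2 - 2 * (1 / 2) ^+ n.
  by rewrite gerBl mulr_ge0// exprn_ge0.
elim: n => [|n IH]; first by rewrite big_nil expr0; ring.
by rewrite big_nat_recr//= IH exprS; field.
Qed.

Lemma sqr_leX4 (k : nat) : (k ^ 2 <= 4 ^ k)%N.
Proof.
rewrite (_ : 4 = 2 ^ 2)%N// -expnM mulnC expnM leq_exp2r//.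
by rewrite ltnW// ltn_expl.
Qed.

Section Series.
Variables (a : nat -> R[i]) (B rho : R).
Hypotheses (rho0 : 0 < rho) (aB : forall k, rnorm (a k) * (8 * rho) ^+ k <= B).
Let S n x := \sum_(0 <= k < n) a k * x ^+ k.
Let D n y := \sum_(0 <= k < n) a k * (y ^+ k.-1 *+ k).

(** In the bound [aB] one has 8 = 4 * 2: the powers of 4 absorb the [k ^ 2] of [power_quad], and the
    powers of 2 leave a geometric series of sum at most 2. The estimate is uniform in [n]. *)
Lemma partial_sum_quad n x y : rnorm x <= rho -> rnorm y <= rho ->
  rnorm (S n x - S n y - D n y * (x - y)) <= 2 * B / rho ^+ 2 * rnorm (x - y) ^+ 2.
Proof.
move=> xr yr; have r2 : 0 < rho ^+ 2 by rewrite exprn_gt0.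
have B0 : 0 <= B by apply: le_trans (aB 0); rewrite mulr_ge0 ?rnorm_ge0.
have -> : S n x - S n y - D n y * (x - y) =
    \sum_(0 <= k < n) a k * (x ^+ k - y ^+ k - (y ^+ k.-1 *+ k) * (x - y)).
  rewrite /S /D mulr_suml -!sumrB; apply: eq_bigr => k _.
  by move: (y ^+ k.-1 *+ k) (x ^+ k) (y ^+ k) => u p q; ring.
apply: le_trans (rnorm_sum _ _ _) _.
rewrite mulrAC ler_pdivlMr// mulr_suml.
apply: (@le_trans _ _ (\sum_(0 <= k < n) (B * rnorm (x - y) ^+ 2) * (1 / 2) ^+ k)).
  apply: ler_sum => k _; rewrite rnormM -[leLHS]mulrA [_ * rho ^+ 2]mulrC.
  have := power_quad k xr yr => /(ler_wpM2l (rnorm_ge0 (a k))) h.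
  apply: le_trans h _.
  have k4 : (k%:R : R) ^+ 2 <= 4 ^+ k by rewrite -!natrX ler_nat sqr_leX4.
  have h1 : rnorm (a k) * (k%:R ^+ 2 * rho ^+ k) <= B * (1 / 2) ^+ k.
    apply: (@le_trans _ _ (rnorm (a k) * (8 * rho) ^+ k * (1 / 2) ^+ k)).
      rewrite -mulrA ler_wpM2l ?rnorm_ge0//.
      have -> : (8 * rho) ^+ k * (1 / 2) ^+ k = 4 ^+ k * rho ^+ k.
        by rewrite -!exprMn; congr (_ ^+ k); field.
      by rewrite ler_wpM2r// exprn_ge0// ltW.
    by rewrite ler_wpM2r// exprn_ge0.
  by rewrite [leLHS]mulrA [leRHS]mulrAC ler_wpM2r// exprn_ge0// rnorm_ge0.
rewrite -mulr_sumr -[leRHS]mulrA [leRHS]mulrC ler_wpM2l ?sum_half_le//.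
by rewrite mulr_ge0// exprn_ge0// rnorm_ge0.
Qed.

Variable f : R[i] -> R[i].
Hypothesis Sf : forall x, rnorm x <= rho -> S n x @[n --> \oo] --> f x.

(** For [x] near [y] every [D n y] with [n] large is close to the quotient (f x - f y) / (x - y),
    which does not depend on [n]; so these sums form a Cauchy sequence. *)
Lemma derivative_sum_cvg y : rnorm y < rho -> exists l : R[i], D n y @[n --> \oo] --> l.
Proof.
move=> yr; pose M := 2 * B / rho ^+ 2.
have B0 : 0 <= B by apply: le_trans (aB 0); rewrite mulr_ge0 ?rnorm_ge0.
have M0 : 0 <= M by rewrite divr_ge0 ?exprn_ge0 ?(ltW rho0)// mulr_ge0.
have [l lP] : exists l : R[i], forall e : R, 0 < e -> \forall n \near \oo, rnorm (l - D n y) < e.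
  apply: complex_cauchy => e e0.
  (* The step [t] keeps [y + t] in the closed disk of radius [rho] and makes the quadratic error
     [M * t ^+ 2] at most [t * e / 8]. *)
  pose t := Num.min (rho - rnorm y) (e / (8 * (M + 1))).
  have t0 : 0 < t.
    by rewrite lt_min subr_gt0 yr divr_gt0// mulr_gt0// ltr_wpDl.
  have tr : t <= rho - rnorm y by rewrite ge_min lexx.
  have te : 8 * (M + 1) * t <= e.
    rewrite mulrC -ler_pdivlMr ?mulr_gt0 ?ltr_wpDl//.
    by rewrite ge_min lexx orbT.
  have Mt : M * t <= e / 8 by have := mulr_ge0 M0 (ltW t0); lra.
  pose x := y + (t%:C)%C.
  have xy : x - y = (t%:C)%C by rewrite /x addrAC subrr add0r.
  have nt : rnorm (x - y) = t by rewrite xy rnorm_real gtr0_norm.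
  have xr : rnorm x <= rho.
    have := rnorm_distD x y 0; rewrite !subr0 nt; lra.
  have eta0 : 0 < t * (e / 16) by rewrite mulr_gt0// divr_gt0.
  have /cvg_rnorm/(_ _ eta0)[N1 _ P1] := Sf xr.
  have /cvg_rnorm/(_ _ eta0)[N2 _ P2] := Sf (ltW yr).
  have key n : (N1 <= n)%N -> (N2 <= n)%N ->
      rnorm (f x - f y - D n y * (x - y)) <= t * (e / 4).
    move=> n1 n2; have := partial_sum_quad n xr (ltW yr); rewrite -/M nt.
    have -> : f x - f y - D n y * (x - y) = (f x - S n x) - (f y - S n y) +
      (S n x - S n y - D n y * (x - y)) by ring.
    have := rnormD ((f x - S n x) - (f y - S n y)) (S n x - S n y - D n y * (x - y)).
    have := rnormB (f x - S n x) (f y - S n y).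
    have := P1 n n1; have := P2 n n2 => /=.
    have := ler_wpM2l (ltW t0) Mt; rewrite expr2; lra.
  exists (maxn N1 N2) => m n; rewrite !geq_max => /andP[m1 m2] /andP[n1 n2].
  rewrite -(ltr_pM2l t0) -{1}nt mulrC -rnormM.
  have -> : (D m y - D n y) * (x - y) =
    (f x - f y - D n y * (x - y)) - (f x - f y - D m y * (x - y)) by ring.
  apply: le_lt_trans (rnormB _ _) _.
  have := key m m1 m2; have := key n n1 n2; have := mulr_gt0 t0 e0; lra.
by exists l; apply/cvg_rnorm.
Qed.

End Series.

Lemma cvg_terms_bounded (u : nat -> R[i]) (l : R[i]) :
  \sum_(0 <= k < n) u k @[n --> \oo] --> l -> exists B : R, forall k, rnorm (u k) <= B.
Proof.
move=> /cvg_rnorm ul; have [N _ NP] := ul 1 ltr01.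
exists (2 + \sum_(0 <= k < N) rnorm (u k)) => k.
have s0 n : 0 <= \sum_(0 <= k < n) rnorm (u k).
  by rewrite sumr_ge0// => j _; exact: rnorm_ge0.
have [Nk|kN] := leqP N k.
  have := NP k Nk; have := NP k.+1 (leqW Nk); rewrite /= big_nat_recr//=.
  set s := \sum_(_ <= _ < _) u _ => h1 h2.
  have -> : u k = (l - s) - (l - (s + u k)) by ring.
  by apply: le_trans (rnormB _ _) _; have := s0 N; lra.
rewrite (@big_cat_nat _ _ _ k.+1)//= big_nat_recr//=.
have : 0 <= \sum_(k.+1 <= j < N) rnorm (u j).
  by rewrite sumr_ge0// => j _; exact: rnorm_ge0.
by have := s0 k; lra.
Qed.

(** The partial sums satisfy the quadratic estimate with one constant, which passes to the limit;
    the limit of the differentiated sums is then recognised as [derive1 f]. *)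
Lemma analytic_quad_diff (U : set R[i]) (f : R[i] -> R[i]) :
  analytic_on U f -> quad_diff U f (derive1 f).
Proof.
move=> af z0 Uz0; have [a [r [r0 ar]]] := af _ Uz0.
(* Thus [8 * rho] is [r / 2], a point inside the disk of convergence, and the terms of the series
   there are bounded. *)
pose rho := r / 16; have rho0 : 0 < rho by rewrite /rho; lra.
have arho (x : R[i]) : rnorm x < r -> \sum_(0 <= k < n) a k * x ^+ k @[n --> \oo] --> f (z0 + x).
  by move=> xr; have := ar (z0 + x); rewrite addrAC subrr add0r rnormE ltcR; exact.
have [B BP] : exists B : R, forall k, rnorm (a k) * (8 * rho) ^+ k <= B.
  have r2 : rnorm (((8 * rho)%:C)%C : R[i]) < r by rewrite rnorm_real ger0_norm /rho; lra.
  have [B BP] := cvg_terms_bounded (arho _ r2); exists B => k.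
  by have := BP k; rewrite rnormM rnormX rnorm_real ger0_norm// mulr_ge0// ltW.
have B0 : 0 <= B by apply: le_trans (BP 0%N); rewrite mulr_ge0 ?rnorm_ge0.
have Sf (x : R[i]) : rnorm x <= rho -> \sum_(0 <= k < n) a k * x ^+ k @[n --> \oo] --> f (z0 + x).
  by move=> xr; apply: arho; apply: le_lt_trans xr _; rewrite /rho; lra.
pose M := 2 * B / rho ^+ 2.
have M0 : 0 <= M by rewrite divr_ge0 ?exprn_ge0 ?(ltW rho0)// mulr_ge0.
have main (w : R[i]) : rnorm (w - z0) < rho -> exists c : R[i], forall z : R[i], rnorm (z - z0) < rho ->
    rnorm (f z - f w - c * (z - w)) <= M * rnorm (z - w) ^+ 2.
  move=> wr; have [c cP] := derivative_sum_cvg rho0 BP Sf wr; exists c => z zr.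
  have hz := Sf _ (ltW zr); have hw := Sf _ (ltW wr).
  rewrite (addrC z0) subrK in hz; rewrite (addrC z0) subrK in hw.
  have zw : z - w = (z - z0) - (w - z0) by ring.
  have hc : ((fun n => \sum_(0 <= k < n) a k * ((w - z0) ^+ k.-1 *+ k)) \*
      (fun=> z - w)) @ \oo --> c * (z - w).
    by apply: (@cvgM R[i] nat \oo); [exact: cP|exact: cvg_cst].
  have lim : (fun n => \sum_(0 <= k < n) a k * (z - z0) ^+ k -
      \sum_(0 <= k < n) a k * (w - z0) ^+ k -
      (\sum_(0 <= k < n) a k * ((w - z0) ^+ k.-1 *+ k)) * (z - w)) @ \oo -->
      f z - f w - c * (z - w).
    apply: (@cvgB R[i] R[i] nat \oo); last exact: hc.
    by apply: (@cvgB R[i] R[i] nat \oo); [exact: hz|exact: hw].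
  apply: (rnorm_lim_le lim); apply: nearW => n /=.
  by rewrite zw; exact: (partial_sum_quad rho0 BP n (ltW zr) (ltW wr)).
(* Halving the radius keeps a whole disk of radius [rho / 2] about [w] inside the region of [main],
   so that the derivative at [w] can be read off. *)
exists M, (rho / 2); split=> //; first by lra.
move=> z w zr wr; have [|c cP] := main w; first by lra.
suff -> : derive1 f w = c by apply: cP; lra.
apply: (quad_diff_derive1 (r := rho / 2) M0); first by lra.
move=> v vr; apply: cP; have := rnorm_distD v w z0; lra.
Qed.

End PowerSeries.

(** * The space of linear maps and its completion *)

Section LinearMapsTopology.
Context {K : numFieldType} {D : lmodType K} {G : normedModType K}.
Local Notation F := (linear_maps D G).
Local Notation ev P v := ((P : {linear D -> G}) v).

(** An entourage of [F] contains a finite intersection of entourages that each look at one vector,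
    and filters are closed under finite intersections. *)
Lemma linear_maps_entourage T (B : set_system T) {FB : Filter B} (P Q : T -> F) :
  (forall v (A : set (G * G)), entourage A -> \forall x \near B, A (ev (P x) v, ev (Q x) v)) ->
  forall A : set (F * F), entourage A -> \forall x \near B, A (P x, Q x).
Proof.
move=> PQ A [V + VA]; move=> [_ [J _ <-]] JV.
have H := @filter_bigI T _ J (fun i => [set x | (projT1 i).2
  ((fun v => ev (P x) v) : {ptws D -> G}, (fun v => ev (Q x) v) : {ptws D -> G})]) B FB.
apply: filterS (H _) => [x xJ|[[v C] /= eC] _]; first by apply: VA; apply: JV.
have /asboolP [C' eC' C'C] := eC.
by apply: filterS (PQ v _ eC') => x xC; apply: C'C.
Qed.

End LinearMapsTopology.

Section Completion.
Context {R : realType} {D : lmodType R[i]} {G : normedModType R[i]}.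
Local Notation F := (linear_maps D G).
Local Notation ev P v := ((P : {linear D -> G}) v).
Variables (Fhat : tvsType R[i]) (iF : {linear F -> Fhat}).
Lemma completion_quotient (c : R[i]) (P Q : F) : iF (c *: (P - Q)) = c *: (iF P - iF Q).
Proof. by rewrite linearZ/= linearB. Qed.

Hypothesis Fhat_completion : hausdorff_completion iF.

(** An arbitrary index type and filter are allowed, so that limits, continuity and uniform
    convergence in [Fhat] all reduce to pointwise estimates in the norm of [G]. *)
Lemma completion_near T (B : set_system T) {FB : Filter B} (P Q : T -> F) :
  (forall v (e : R), 0 < e -> \forall x \near B, rnorm (ev (P x) v - ev (Q x) v) < e) ->
  forall A : set (Fhat * Fhat), entourage A -> \forall x \near B, A (iF (P x), iF (Q x)).
Proof.
move=> PQ A eA.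
have eB : entourage [set PQ : F * F | A (iF PQ.1, iF PQ.2)].
  by apply/(completion_entourage Fhat_completion); exists A.
apply: (linear_maps_entourage (P := P) (Q := Q) _ eB) => v C /entourage_rnorm[e e0 eC].
by apply: filterS (PQ v e e0) => x; exact: eC.
Qed.

Lemma completion_cvg T (B : set_system T) {FB : Filter B} (Q : T -> F) (P : F) :
  (forall v (e : R), 0 < e -> \forall x \near B, rnorm (ev P v - ev (Q x) v) < e) ->
  (fun x => iF (Q x)) @ B --> iF P.
Proof.
move=> PQ; apply/cvg_entourageP => A eA.
exact: (completion_near (P := fun=> P) PQ eA).
Qed.

Lemma completion_uniform (W : set R) (u : nat -> R -> F) (h : R -> F) :
  (forall v (e : R), 0 < e -> \forall k \near \oo, forall t, W t ->
     rnorm (ev (h t) v - ev (u k t) v) < e) ->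
  {uniform W, (fun k t => iF (u k t)) @ \oo --> (fun t => iF (h t))}.
Proof.
move=> uh; apply/uniform_entourageP => A eA.
(* Uniformity in [t] is encoded in this filter on pairs. *)
pose B := [set S : set (nat * R) | \forall k \near \oo, forall t, W t -> S (k, t)].
have FB : Filter B.
  split; first by exists 0%N.
    move=> S S' [N _ h1] [N' _ h2]; exists (maxn N N') => // k /=.
    by rewrite geq_max => /andP[k1 k2] t Wt; split; [exact: h1|exact: h2].
  by move=> S S' SS' [N _ h1]; exists N => // k Nk t Wt; apply: SS'; exact: h1.
have := @completion_near _ B FB (fun kt => h kt.2) (fun kt => u kt.1 kt.2) uh A eA.
by [].
Qed.

Lemma completion_continuous (W : set R) (h : R -> F) :
  (forall t, W t -> forall v (e : R), 0 < e -> \forall s \near t,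
     W s -> rnorm (ev (h t) v - ev (h s) v) < e) ->
  {within W, continuous (fun t => iF (h t))}.
Proof.
move=> hc; apply/subspace_continuousP => t Wt.
apply: completion_cvg => v e e0.
by apply: filterS (hc t Wt v e e0) => s sP Ws; exact: sP.
Qed.

End Completion.

(** * Dilations *)

Section DilatedCalculus.
Context {R : realType} {G : completeNormedModType R[i]}.
Local Notation borelC := (g_sigma_algebraType (@open R[i])).
Variables (E : set R[i] -> bounded_op G) (M : R).
Hypotheses (sE : spectral_measure E) (M0 : 0 < M).
Hypothesis EM : forall A : set borelC, measurable A ->
  forall v, rnorm (E A v) <= M * rnorm v.
Implicit Types (U : set R[i]) (p q : R[i] -> R[i]) (v : G).

(** A bound for the essential supremum of [p] on [U] in witness form, which supplies the essential
    set over which to integrate. *)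
Definition ess_le U p (e : R) := exists2 d : set borelC, essential E d &
  forall l, U l -> d l -> rnorm (p l) <= e.

Lemma ess_leB U p q r (e e' : R) : ess_le U (p \- q) e -> ess_le U (r \- q) e' ->
  ess_le U (p \- r) (e + e').
Proof.
move=> [d ed dP] [d' ed' dP']; exists (d `&` d'); first exact: essentialI.
move=> l Ul [dl d'l] /=; apply: le_trans (rnorm_distD _ (q l) _) _.
by rewrite (rnormBC (q l)); apply: lerD; [exact: dP|exact: dP'].
Qed.

Definition admissible U p := measurable_fun (U : set borelC) (p : borelC -> borelC) /\
  exists c : R, ess_le U p c.

Lemma in_Linf_admissible U p : in_Linf E U p -> admissible U p.
Proof.
by move=> [mp /Linf_norm_fin[d ed [c dc]]]; split=> //; exists c, d.
Qed.

Lemma fun_calc_distance U p q v (e : R) : open U -> admissible U p -> admissible U q ->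
  0 < e -> ess_le U (p \- q) e ->
  rnorm (fun_calc E U p v - fun_calc E U q v) <= 8 * e * (M * rnorm v).
Proof.
move=> oU [mp [c [d ed dP]]] [mq [c' [d' ed' dP']]] e0 [d'' ed'' dP''].
have mU : measurable (U : set borelC) := borel_open oU.
pose D : set borelC := d `&` (d' `&` d'').
have eD : essential E D by do 2 apply: essentialI => //.
have mUD : measurable ((U : set borelC) `&` D) by apply: measurableI => //; case: eD.
have bp := fun_calcP sE M0 EM mU mp eD (fun l Ul Dl => dP l Ul Dl.1) v.
have bq := fun_calcP sE M0 EM mU mq eD (fun l Ul Dl => dP' l Ul Dl.2.1) v.
apply: (bint_bound sE EM mUD (bintB sE mUD bp bq) e0) => l [Ul Dl].
exact: dP'' Dl.2.2.
Qed.

Lemma fun_calcB U p q v : open U -> admissible U p -> admissible U q ->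
  admissible U (p \- q) ->
  fun_calc E U (p \- q) v = fun_calc E U p v - fun_calc E U q v.
Proof.
move=> oU [mp [c [d ed dP]]] [mq [c' [d' ed' dP']]] [mpq [c'' [d'' ed'' dP'']]].
have mU : measurable (U : set borelC) := borel_open oU.
pose D : set borelC := d `&` (d' `&` d'').
have eD : essential E D by do 2 apply: essentialI => //.
have mUD : measurable ((U : set borelC) `&` D) by apply: measurableI => //; case: eD.
have bp := fun_calcP sE M0 EM mU mp eD (fun l Ul Dl => dP l Ul Dl.1) v.
have bq := fun_calcP sE M0 EM mU mq eD (fun l Ul Dl => dP' l Ul Dl.2.1) v.
have bpq := fun_calcP sE M0 EM mU mpq eD (fun l Ul Dl => dP'' l Ul Dl.2.2) v.
exact: (bint_unique sE M0 EM mUD bpq (bintB sE mUD bp bq)).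
Qed.

(** Rounding [x - lo] down to a multiple of 1 / (m + 1) gives a point that stays in the interval.
    The grid is indexed by two naturals, so a countable intersection of essential sets serves all
    its points. *)
Lemma grid_dense (lo hi x e : R) : lo <= x <= hi -> 0 < e -> exists m k : nat,
  lo <= Num.min (lo + k%:R / m.+1%:R) hi <= hi /\
  `|Num.min (lo + k%:R / m.+1%:R) hi - x| <= e.
Proof.
move=> /andP[lx xh] e0.
have [N _ /(_ N (leqnn N)) /= Ne] := near_infty_natSinv_lt (PosNum e0).
have N0 : 0 < N.+1%:R :> R by rewrite ltr0n.
have xl : 0 <= (x - lo) * N.+1%:R by rewrite mulr_ge0 ?subr_ge0// ltW.
exists N, (Num.truncn ((x - lo) * N.+1%:R)).
have /andP[k1 k2] := truncn_itv xl; set k := Num.truncn _ in k1 k2 *.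
have h1 : k%:R / N.+1%:R <= x - lo by rewrite ler_pdivrMr.
have h2 : x - lo < k%:R / N.+1%:R + N.+1%:R^-1.
  by rewrite -ltr_pdivlMr// -natr1 mulrDl mul1r in k2.
have h0 : 0 <= k%:R / N.+1%:R :> R by rewrite divr_ge0.
set q := k%:R / _ in h0 h1 h2 *; set r := N.+1%:R^-1 in h2 Ne; clearbody q r.
rewrite (min_idPl _); last by lra.
by split; [apply/andP; split|rewrite ler_norml; apply/andP; split]; lra.
Qed.

Variable A : unbounded_op G.
Hypothesis sA : scalar_type A E.

Lemma dilation_continuous U f d (t : R) : quad_diff U f d ->
  (forall l, U l -> U ((t%:C)%C * l)) ->
  forall z, U z -> {for z, continuous (dilation f t)}.
Proof.
move=> qf Ut z Uz; apply: (@continuous_comp _ _ _ (fun l : R[i] => (t%:C)%C * l) f).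
  by apply: (@cvgM R[i] R[i] (nbhs z) _ (fun=> (t%:C)%C) id); [exact: cvg_cst|exact: cvg_id].
exact: quad_diff_continuous qf (Ut _ Uz).
Qed.

(* Off a null set the hypothesis holds for s in a countable dense subset of the
   segment, hence by continuity of d for all s. *)
Lemma ess_le_segment U d c (lo hi e : R) f : quad_diff U f d ->
  (forall s l, lo <= s <= hi -> U l -> U ((s%:C)%C * l)) ->
  (forall s, lo <= s <= hi -> ess_le U (dilation d s \- c) e) ->
  exists2 D : set borelC, essential E D & forall l, U l -> D l ->
    forall s, lo <= s <= hi -> rnorm (d ((s%:C)%C * l) - c l) <= e.
Proof.
move=> qf KU de.
pose y (m k : nat) := Num.min (lo + k%:R / m.+1%:R) hi.
have exD mk : exists D : set borelC, essential E D /\ (lo <= y mk.1 mk.2 <= hi ->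
    forall l, U l -> D l -> rnorm (d (((y mk.1 mk.2)%:C)%C * l) - c l) <= e).
  have [yK|nyK] := pselect (lo <= y mk.1 mk.2 <= hi).
    by have [D eD DP] := de _ yK; exists D.
  by exists setT; split=> //; split=> // v; exact: spectral_measureT.
have [D DP] := choice exD.
exists (\bigcap_m \bigcap_k D (m, k)).
  apply: (essential_bigcap sE (d := fun m => \bigcap_k D (m, k))) => m.
  by apply: (essential_bigcap sE (d := fun k => D (m, k))) => k; exact: (DP (m, k)).1.
move=> l Ul Dl s sK; apply/ler_addgt0Pr => eta eta0.
have [L [r [L0 r0 H]]] := quad_diff_lipschitz qf (KU s l sK Ul).
have k0 : 0 < (rnorm l + 1) * (L + 1) by rewrite mulr_gt0 ?ltr_wpDl ?rnorm_ge0.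
have k1 : 0 < rnorm l + 1 by rewrite ltr_wpDl ?rnorm_ge0.
(* The first entry brings the grid point times [l] into the disk where [d] is Lipschitz; the second
   makes the resulting variation of [d] at most [eta]. *)
pose del := Num.min (r / 2 / (rnorm l + 1)) (eta / ((rnorm l + 1) * (L + 1))).
have del0 : 0 < del by rewrite lt_min !divr_gt0.
have [m [k [yK ys]]] := grid_dense sK del0; rewrite -/(y m k) in yK ys.
have yl : rnorm (((y m k)%:C)%C * l - (s%:C)%C * l) <= del * rnorm l.
  by rewrite -mulrBl -rmorphB/= rnormM rnorm_real ler_wpM2r ?rnorm_ge0.
have d1 : del * (rnorm l + 1) <= r / 2 by rewrite -ler_pdivlMr// ge_min lexx.
have d2 : del * ((rnorm l + 1) * (L + 1)) <= eta.
  by rewrite -ler_pdivlMr// ge_min lexx orbT.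
have yr : rnorm (((y m k)%:C)%C * l - (s%:C)%C * l) < r.
  by apply: le_lt_trans yl _; lra.
have := H _ ((s%:C)%C * l) yr; rewrite subrr rnorm0 => /(_ r0) h.
have := (DP (m, k)).2 yK l Ul (Dl m I k I) => /= hD.
apply: le_trans (rnorm_distD _ (d (((y m k)%:C)%C * l)) _) _.
rewrite rnormBC addrC; apply: lerD => //; apply: le_trans h _.
apply: le_trans d2; apply: le_trans (ler_wpM2l L0 yl) _.
have : 0 <= del * rnorm l by rewrite mulr_ge0 ?rnorm_ge0// ltW.
have : 0 <= del * L by rewrite mulr_ge0// ltW.
by move: (ltW del0); nra.
Qed.

Lemma segment_increment U f d (l c : R[i]) (t t' e : R) : quad_diff U f d ->
  (forall s, Num.min t t' <= s <= Num.max t t' -> U ((s%:C)%C * l)) ->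
  (forall s, Num.min t t' <= s <= Num.max t t' -> rnorm (d ((s%:C)%C * l) - c) <= e) ->
  rnorm (f ((t'%:C)%C * l) - f ((t%:C)%C * l) - ((t' - t)%:C)%C * l * c)
    <= e * `|t' - t| * rnorm l.
Proof.
move=> qf Ul de; have [tt'|tt'] := leP t t'.
  rewrite (min_idPl tt') (max_idPr tt') in Ul de.
  by rewrite ger0_norm ?subr_ge0// (mulrC e); exact: (segment_mean_value qf tt' Ul de).
have {}tt' := ltW tt'; rewrite (min_idPr tt') (max_idPl tt') in Ul de.
have := segment_mean_value qf tt' Ul de.
rewrite distrC ger0_norm ?subr_ge0// (mulrC e) => h.
have -> : f ((t'%:C)%C * l) - f ((t%:C)%C * l) - ((t' - t)%:C)%C * l * c =
    - (f ((t%:C)%C * l) - f ((t'%:C)%C * l) - ((t - t')%:C)%C * l * c).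
  by rewrite -(opprB t t') rmorphN/=; ring.
by rewrite rnormN.
Qed.

Lemma dilation_increment U f d c (t t' e : R) (u : Dom A) : open U ->
  quad_diff U f d ->
  (forall s l, Num.min t t' <= s <= Num.max t t' -> U l -> U ((s%:C)%C * l)) ->
  0 < e -> admissible U c ->
  admissible U (dilation f t) -> admissible U (dilation f t') ->
  (forall s, Num.min t t' <= s <= Num.max t t' -> ess_le U (dilation d s \- c) e) ->
  rnorm (fun_calc E U (dilation f t') (val u) - fun_calc E U (dilation f t) (val u) -
         ((t' - t)%:C)%C *: fun_calc E U c (A u)) <= 8 * (e * `|t' - t|) * (M * rnorm (A u)).
Proof.
move=> oU qf KU e0 [mc [bc [dc edc dcP]]] [_ [b [d0 ed0 d0P]]] [_ [b' [d0' ed0' d0P']]] de.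
(* The case [t' = t] is set apart because [fun_calc_increment] takes a positive error, here
   [e * |t' - t|]. *)
have [->|tt'] := eqVneq t' t.
  by rewrite !subrr normr0 scale0r subrr rnorm0 !(mulr0, mul0r).
have [D eD DP] := ess_le_segment qf KU de.
pose D' : set borelC := dc `&` (d0 `&` (d0' `&` D)).
have eD' : essential E D' by do 3 apply: essentialI => //.
have tm : Num.min t t' <= t <= Num.max t t' by rewrite ge_min lexx le_max lexx.
have tm' : Num.min t t' <= t' <= Num.max t t' by rewrite ge_min lexx le_max lexx !orbT.
apply: (fun_calc_increment sE M0 EM sA (d := D') (b := Num.max bc (Num.max b b'))) => //.
- by apply: dilation_continuous qf _ => l; exact: KU.
- by apply: dilation_continuous qf _ => l; exact: KU.
- by rewrite mulr_gt0// normr_gt0 subr_eq0.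
- move=> l Ul [l1 [l2 [l3 _]]]; rewrite !le_max.
  by rewrite d0P// d0P'// dcP// !orbT.
move=> l Ul [_ [_ [_ Dl]]].
apply: (segment_increment qf) => s sK; first exact: KU.
exact: DP.
Qed.

End DilatedCalculus.

Lemma pointwise_limit_linear {R : realType} {D : lmodType R[i]}
    {G : normedModType R[i]} (w : nat -> {linear D -> G}) :
  (forall u, exists l : G, w k u @[k --> \oo] --> l) ->
  exists P : {linear D -> G}, forall u, w k u @[k --> \oo] --> P u.
Proof.
move=> /choice[h hP]; have hL : linear h.
  move=> c u v; apply: (cvg_unique _ (hP (c *: u + v))); first exact: norm_hausdorff.
  have -> : (fun k => w k (c *: u + v)) = (fun k => c *: w k u + w k v).
    by apply/funext => k; exact: linearP.
  by apply: cvgD; [apply: cvgZr|].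
pose P : {linear D -> G} := HB.pack h (GRing.isLinear.Build R[i] D G *:%R h hL).
by exists P.
Qed.

Lemma homo_ge_id (phi : nat -> nat) : {homo phi : m n / (m < n)%N} ->
  forall n, (n <= phi n)%N.
Proof. by move=> pm; elim=> // n IH; exact: leq_ltn_trans IH (pm _ _ (ltnSn n)). Qed.

Lemma ess_le_ext {R : realType} {G : completeNormedModType R[i]}
    (E : set R[i] -> bounded_op G) (U : set R[i]) (p q : R[i] -> R[i]) (e : R) :
  (forall l, U l -> p l = q l) -> ess_le E U p e -> ess_le E U q e.
Proof. by move=> pq [d ed dP]; exists d => // l Ul dl; rewrite -pq//; exact: dP. Qed.

Lemma ext0E {R : realType} (U : set R[i]) (p : R[i] -> R[i]) l :
  U l -> ext0 U p l = p l.
Proof. by move=> Ul; rewrite /ext0 mem_set. Qed.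

(** * Estimates for dilations with parameters in the interval *)

Section Estimates.
Context {R : realType} {G : completeNormedModType R[i]}.
Local Notation borelC := (g_sigma_algebraType (@open R[i])).
Variables (A : unbounded_op G) (E : set R[i] -> bounded_op G).
Hypothesis A_scalar : scalar_type A E.
Variables (a b : R) (K : set R) (K_itv : K = `[a, b]%classic).
Variables (U : set R[i]) (U_open : open U).
Hypothesis KU : forall (t : R) (l : R[i]), K t -> U l -> U ((t%:C)%C * l).

Let sE := A_scalar.1.

Lemma itv_between s t r : K s -> K t -> Num.min s t <= r <= Num.max s t -> K r.
Proof.
rewrite K_itv /= !in_itv/= => /andP[h1 h2] /andP[h3 h4].
rewrite ge_min le_max => /andP[h5 h6]; apply/andP; split.
  by case/orP: h5; apply: le_trans.
by case/orP: h6 => h; apply: (le_trans h).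
Qed.

Lemma itv_dist s t : K s -> K t -> `|s - t| <= b - a.
Proof.
rewrite K_itv /= !in_itv/= => /andP[? ?] /andP[? ?].
by rewrite ler_norml; apply/andP; split; lra.
Qed.

Lemma itv_between_dist (s t r : R) : Num.min s t <= r <= Num.max s t -> `|s - r| <= `|s - t|.
Proof.
by case: (leP s t) => st /andP[h1 h2]; [rewrite !ler0_norm|rewrite !ger0_norm]; lra.
Qed.

Section Dilation.
Variables (f : R[i] -> R[i]).
Hypothesis f_analytic : analytic_on U f.
Hypothesis f_bounded :
  (ereal_sup [set Linf_norm E U (ext0 U (dilation f t)) | t in K] < +oo)%E.

Lemma dilation_measurable d (h : R[i] -> R[i]) t : quad_diff U h d -> K t ->
  measurable_fun (U : set borelC) (dilation h t : borelC -> borelC).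
Proof.
move=> qh Kt; apply: borel_continuous => //.
by apply: dilation_continuous qh _ => l; exact: KU.
Qed.

Lemma dilation_admissible t : K t -> admissible E U (dilation f t).
Proof.
move=> Kt; split; first exact: dilation_measurable (analytic_quad_diff f_analytic) Kt.
have [|d ed [c dc]] := @Linf_norm_fin _ _ E U (ext0 U (dilation f t)).
  by apply: le_lt_trans f_bounded; apply: ereal_sup_ubound; exists t.
by exists c, d => // l Ul dl; rewrite -(ext0E _ Ul); exact: dc.
Qed.

End Dilation.

Lemma admissibleB p q : measurable_fun (U : set borelC) (p \- q : borelC -> borelC) ->
  admissible E U p -> admissible E U q -> admissible E U (p \- q).
Proof.
move=> mpq [_ [c [d ed dP]]] [_ [c' [d' ed' dP']]]; split=> //.
exists (c + c'), (d `&` d'); first exact: essentialI.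
move=> l Ul [dl d'l] /=; apply: le_trans (rnormB _ _) _.
by apply: lerD; [exact: dP|exact: dP'].
Qed.

Lemma fun_calc0 v : fun_calc E U (fun=> 0) v = 0.
Proof.
have [M M0 EM] := spectral_measure_bounded sE.
have a0 : admissible E U (fun=> 0).
  split; first exact: measurable_cst.
  exists 0, setT; last by move=> l _ _; rewrite rnorm0.
  by split=> // w; exact: spectral_measureT.
have e0 : (fun=> 0) \- (fun=> 0) = (fun=> 0) :> (R[i] -> R[i]).
  by apply/funext => l /=; rewrite subr0.
have := fun_calcB sE M0 EM v U_open a0 a0; rewrite e0 subrr; exact.
Qed.

Lemma dilation_difference (f h : R[i] -> R[i]) (M : R) (M0 : 0 < M)
    (EM : forall B : set borelC, measurable B -> forall v, rnorm (E B v) <= M * rnorm v)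
    (t t' e : R) (u : Dom A) :
  analytic_on U f -> analytic_on U h ->
  (forall s, K s -> admissible E U (dilation f s)) ->
  (forall s, K s -> admissible E U (dilation h s)) ->
  K t -> K t' -> 0 < e ->
  (forall s, K s -> ess_le E U (dilation (derive1 f) s \- dilation (derive1 h) s) e) ->
  rnorm ((fun_calc E U (dilation f t') (val u) - fun_calc E U (dilation h t') (val u)) -
         (fun_calc E U (dilation f t) (val u) - fun_calc E U (dilation h t) (val u)))
  <= 8 * (e * `|t' - t|) * (M * rnorm (A u)).
Proof.
move=> af ah adf adh Kt Kt' e0 de.
have qd := quad_diffB (analytic_quad_diff af) (analytic_quad_diff ah).
have adB s : K s -> admissible E U (dilation (f \- h) s).
  move=> Ks; apply: (admissibleB (p := dilation f s) (q := dilation h s)).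
  - exact: dilation_measurable qd Ks.
  - exact: adf.
  - exact: adh.
have FB s : K s -> fun_calc E U (dilation (f \- h) s) (val u) =
    fun_calc E U (dilation f s) (val u) - fun_calc E U (dilation h s) (val u).
  move=> Ks; apply: (fun_calcB sE M0 EM _ U_open (p := dilation f s) (q := dilation h s)).
  - exact: adf.
  - exact: adh.
  - exact: adB.
rewrite -(FB t' Kt') -(FB t Kt).
have := @dilation_increment _ _ _ _ sE M0 EM A A_scalar U (f \- h)
  (derive1 f \- derive1 h) (fun=> 0) t t' e u U_open qd.
rewrite fun_calc0 scaler0 subr0; apply => //.
- by move=> s l sK Ul; apply: KU => //; exact: (itv_between Kt Kt').
- split; first exact: measurable_cst.
  exists 0, setT; last by move=> l _ _; rewrite rnorm0.
  by split=> // w; exact: spectral_measureT.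
- exact: adB.
- exact: adB.
move=> s sK; apply: ess_le_ext (de s (itv_between Kt Kt' sK)) => l _ /=.
by rewrite subr0.
Qed.

End Estimates.

(* Otherwise failing unifications unfold the functional calculus. *)
Opaque fun_calc.

(** * Convergence of the subsequence and derivative of the limit *)

Unset Implicit Arguments.
Set Strict Implicit.
Set Printing Implicit Defensive.

Theorem theorem2 (R : realType) (G : completeNormedModType R[i])
    (A : unbounded_op G) (E : set R[i] -> bounded_op G)
    (A_scalar : scalar_type A E)
    (a b : R) (ab : a < b) (K : set R) (K_itv : K = `[a, b]%classic)
    (U : set R[i]) (U_open : open U) (U_spectrum : spectrum A `<=` U)
    (KU : forall (t : R) (l : R[i]), K t -> U l -> U ((t%:C)%C * l))
    (X : topologicalType) (X_compact : compact [set: X])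
    (X_seq_compact : seq_compact X)
    (g : X -> R -> R[i] -> R[i]) (g_continuous : continuous_Linf E U K g)
    (x : nat -> X) (t0 : R) (Kt0 : K t0)
    (f : nat -> R[i] -> R[i]) (f_analytic : forall n, analytic_on U (f n))
    (f_bounded : forall n,
      (ereal_sup [set Linf_norm E U (ext0 U (dilation (f n) t)) | t in K]
        < +oo)%E)
    (f_cvg : forall v : Dom A, exists w : G,
      fun_calc E U (dilation (f n) t0) (val v) @[n --> \oo] --> w)
    (g_f : forall n t, K t ->
      g (x n) t = ext0 U (dilation (derive1 (f n)) t))
    (Fhat : tvsType R[i]) (iF : {linear linear_maps (Dom A) G -> Fhat})
    (Fhat_completion : hausdorff_completion iF) :
  exists (y : X) (phi : nat -> nat),
    [/\ {homo phi : m n / (m < n)%N},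
        x (phi k) @[k --> \oo] --> y &
        forall W : set R, open W -> W t0 -> W `<=` K ->
          exists h : R -> Fhat,
            [/\ C1_on W h,
                forall t, W t ->
                  has_deriv h t (iF (comp_op A (fun_calc E U (g y t)))) &
                cvg_Cu W
                  (fun k t => iF (restrict_to_dom A
                    (fun_calc E U (dilation (f (phi k)) t)))) h]].
Proof.
have sE := A_scalar.1.
have [M M0 EM] := spectral_measure_bounded sE.
have [gK gc] := g_continuous.
have qf n := analytic_quad_diff (f_analytic n).
have adg z t (Kt : K t) : admissible E U (g z t) := in_Linf_admissible (gK z t Kt).
have adf n t (Kt : K t) : admissible E U (dilation (f n) t).
  exact: (dilation_admissible U_open KU (f_analytic n) (f_bounded n)).
have dg n t (Kt : K t) l : U l -> dilation (derive1 (f n)) t l = g (x n) t l.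
  by move=> Ul; rewrite g_f// ext0E.
have loc z t e : K t -> 0 < e ->
    \forall q \near ((z, t) : X * R), K q.2 -> ess_le E U (g q.1 q.2 \- g z t) e.
  move=> Kt e0; apply: filterS (gc z t Kt e e0) => q qe Kq.
  by have [d ed dP] := Linf_norm_lt (qe Kq); exists d.
have inc n t s (u : Dom A) c e : K t -> K s -> 0 < e -> admissible E U c ->
    (forall r, Num.min t s <= r <= Num.max t s -> ess_le E U (g (x n) r \- c) e) ->
    rnorm (fun_calc E U (dilation (f n) s) (val u) - fun_calc E U (dilation (f n) t) (val u) -
      ((s - t)%:C)%C *: fun_calc E U c (A u)) <= 8 * (e * `|s - t|) * (M * rnorm (A u)).
  move=> Kt Ks e0 ac ce.
  apply: (dilation_increment sE M0 EM A_scalar u U_open (qf n)) => //.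
  - by move=> r l rK Ul; apply: KU => //; exact: (itv_between K_itv Kt Ks).
  - exact: adf.
  - exact: adf.
  move=> r rK; apply: ess_le_ext (ce r rK) => l Ul /=.
  by rewrite dg//; exact: (itv_between K_itv Kt Ks).
have [y [phi [phi_incr xy]]] := X_seq_compact x.
exists y, phi; split => // W oW Wt0 WK.
(* Near each [s] in [K], both g(x_k, s') and g(y, s') are within e / 2 of g(y, s), for [s'] near [s]
   and [k] large; the near-covering form of compactness makes the rank of [k] uniform in [s']. *)
have unif e : 0 < e -> \forall k \near \oo, forall s, K s ->
    ess_le E U (g (x (phi k)) s \- g y s) e.
  move=> e0; have e2 : 0 < e / 2 by lra.
  have : compact K by rewrite K_itv; exact: segment_compact.
  move=> /compact_near_coveringP/(_ nat \oo (fun k s => K s -> ess_le E U (g (x (phi k)) s \- g y s) e) _).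
  case=> [s Ks|N _ NP]; last by exists N => // k Nk s Ks; exact: NP.
  have [[V1 V2] /= [yV1 sV2] VP] := loc y s (e / 2) Ks e2.
  exists (V2, [set k | V1 (x (phi k))]); first by split=> //=; exact: xy.
  move=> [s' k] /= [s'V kV] Ks'; rewrite (splitr e).
  apply: (@ess_leB _ _ _ sE _ _ (g y s)).
    exact: (VP (x (phi k), s') (conj kV s'V) Ks').
  by apply: (VP (y, s')) => //; split=> //; exact: nbhs_singleton yV1.
have [w wE] : exists w : nat -> R -> Dom A -> G, forall k t u,
    w k t u = fun_calc E U (dilation (f (phi k)) t) (val u) by eexists.
have cauchy (u : Dom A) e : 0 < e -> exists N, forall m n, (N <= m)%N -> (N <= n)%N ->
    forall t, K t -> rnorm (w m t u - w n t u) < e.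
  move=> e0; have ba : 0 < b - a by rewrite subr_gt0.
  (* Two derivatives within [e / (2 * L)] of g(y, .) differ by at most [e / L], and the increment
     estimate over a length at most [b - a] then gives [e / 2]. The other half of [e] pays for the
     two distances to the limit at [t0]. *)
  pose L := 16 * (b - a) * (M * rnorm (A u) + 1).
  have MA : 0 <= M * rnorm (A u) by rewrite mulr_ge0 ?rnorm_ge0// ltW.
  have L0 : 0 < L by rewrite !mulr_gt0// ltr_wpDl.
  have e4 : 0 < e / (2 * L) by rewrite divr_gt0// mulr_gt0.
  have [N1 _ P1] := unif _ e4.
  have [l /cvg_rnorm ul] := f_cvg u.
  have e8 : 0 < e / 4 by lra.
  have [N2 _ P2] := ul _ e8.
  exists (maxn N1 N2) => m n; rewrite !geq_max => /andP[m1 m2] /andP[n1 n2] t Kt.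
  have := P2 _ (leq_trans m2 (homo_ge_id phi_incr m)); rewrite /= -wE => hm.
  have := P2 _ (leq_trans n2 (homo_ge_id phi_incr n)); rewrite /= -wE => hn.
  have e5 : 0 < 2 * (e / (2 * L)) by rewrite mulr_gt0.
  have := dilation_difference A_scalar K_itv U_open KU M0 EM u
    (f_analytic (phi m)) (f_analytic (phi n)) (adf (phi m)) (adf (phi n)) Kt0 Kt e5.
  rewrite -!wE => h.
  have {}h : rnorm ((w m t u - w n t u) - (w m t0 u - w n t0 u)) <=
      8 * (2 * (e / (2 * L)) * `|t - t0|) * (M * rnorm (A u)).
    apply: h => s Ks; have -> : 2 * (e / (2 * L)) = e / (2 * L) + e / (2 * L) by ring.
    apply: (@ess_leB _ _ _ sE _ _ (g y s)).
      by apply: ess_le_ext (P1 m m1 s Ks) => l' Ul /=; rewrite dg.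
    by apply: ess_le_ext (P1 n n1 s Ks) => l' Ul /=; rewrite dg.
  have tt0 := itv_dist K_itv Kt Kt0.
  have {}h : rnorm ((w m t u - w n t u) - (w m t0 u - w n t0 u)) <= e / 2.
    apply: le_trans h _.
    have -> : e / 2 = 8 * (2 * (e / (2 * L)) * (b - a)) * (M * rnorm (A u) + 1).
      by rewrite /L; field; rewrite !gt_eqF// ltr_wpDl.
    apply: ler_pM => //; last by lra.
      by rewrite mulr_ge0// mulr_ge0// ltW.
    by apply: ler_wpM2l => //; apply: ler_wpM2l => //; exact: ltW.
  have := rnorm_distD (w m t u - w n t u) (w m t0 u - w n t0 u) 0; rewrite !subr0.
  have := rnorm_distD (w m t0 u) l (w n t0 u); rewrite (rnormBC _ l).
  by lra.
(* Outside [K] the map is given the value 0, which is harmless as [W] lies in [K]. *)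
have [H HP] : exists H : R -> {linear Dom A -> G}, forall t, K t -> forall u,
    w k t u @[k --> \oo] --> H t u.
  have exH t : exists P : {linear Dom A -> G}, K t -> forall u, w k t u @[k --> \oo] --> P u.
    have [Kt|nKt] := pselect (K t); last by exists \0 => /nKt.
    have [|P PP] := @pointwise_limit_linear _ _ _ (fun k =>
      (fun_calc E U (dilation (f (phi k)) t) \o (val : Dom A -> G) : {linear Dom A -> G})).
      move=> u; apply: rnorm_cauchy => e e0; have [N NP] := cauchy u e e0.
      by exists N => m n Nm Nn; have := NP m n Nm Nn t Kt; rewrite !wE.
    by exists P => _ u; under eq_fun do rewrite wE; exact: PP.
  by have [H HP] := choice exH; exists H.
have Hunif (u : Dom A) e : 0 < e -> \forall k \near \oo, forall t, K t ->
    rnorm (H t u - w k t u) < e.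
  move=> e0; have e2 : 0 < e / 2 by lra.
  have [N NP] := cauchy u _ e2; exists N => // k Nk t Kt.
  apply: (@le_lt_trans _ _ (e / 2)); last by lra.
  have : w j t u - w k t u @[j --> \oo] --> H t u - w k t u.
    by apply: cvgB; [exact: HP|exact: cvg_cst].
  move=> /rnorm_lim_le; apply; exists N => // j Nj /=.
  by apply: ltW; exact: NP.
(* Joint continuity of [g] at [(y, t)] gives one ball about [t] that works for all large [k] and all
   parameters between [t] and [s], so the increment estimate survives the limit in [k]. *)
have Hinc (u : Dom A) t e : K t -> 0 < e -> \forall s \near t, K s ->
    rnorm (H s u - H t u - ((s - t)%:C)%C *: fun_calc E U (g y t) (A u)) <=
    8 * (e * `|s - t|) * (M * rnorm (A u)).
  move=> Kt e0; have [[V1 V2] /= [yV1 tV2] VP] := loc y t e Kt e0.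
  have [del /= del0 delP] := (nbhs_ballP _ _).1 tV2.
  apply/nbhs_ballP; exists del => // s ts Ks.
  have : w k s u - w k t u - ((s - t)%:C)%C *: fun_calc E U (g y t) (A u) @[k --> \oo] -->
      H s u - H t u - ((s - t)%:C)%C *: fun_calc E U (g y t) (A u).
    by apply: cvgB; [apply: cvgB; exact: HP|exact: cvg_cst].
  move=> /rnorm_lim_le; apply; have kV : \forall k \near \oo, V1 (x (phi k)) by exact: xy.
  apply: filterS kV => k kV; rewrite !wE; apply: inc => //; first exact: adg.
  move=> r rK; apply: (VP (x (phi k), r)) => /=; last exact: (itv_between K_itv Kt Ks).
  split=> //; apply: delP; apply: le_lt_trans ts; exact: itv_between_dist.
have wcont k (u : Dom A) t e : K t -> 0 < e -> \forall s \near t, K s ->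
    rnorm (w k t u - w k s u) < e.
  move=> Kt e0; pose c := fun_calc E U (g (x (phi k)) t) (A u).
  have [[V1 V2] /= [yV1 tV2] VP] := loc (x (phi k)) t 1 Kt ltr01.
  have [del /= del0 delP] := (nbhs_ballP _ _).1 tV2.
  have MA : 0 <= M * rnorm (A u) by rewrite mulr_ge0 ?rnorm_ge0// ltW.
  (* The increment estimate with error 1 already gives a local Lipschitz bound at [t], with a
     constant smaller than [L]. *)
  pose L := 8 * (M * rnorm (A u)) + rnorm c + 1.
  have L0 : 0 < L by have := rnorm_ge0 c; rewrite /L; lra.
  apply/nbhs_ballP; exists (Num.min del (e / L)); first by rewrite /= lt_min del0 divr_gt0.
  move=> s; rewrite /ball/= lt_min => /andP[ts tsL] Ks.
  have : rnorm (w k s u - w k t u - ((s - t)%:C)%C *: c) <= 8 * (1 * `|s - t|) * (M * rnorm (A u)).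
    rewrite !wE; apply: inc => //; first exact: adg.
    move=> r rK; apply: (VP (x (phi k), r)) => /=; last exact: (itv_between K_itv Kt Ks).
    split; first exact: nbhs_singleton yV1.
    by apply: delP; rewrite /ball/=; apply: le_lt_trans ts; exact: itv_between_dist.
  move: tsL; rewrite ltr_pdivlMr// distrC /L (rnormBC (w k t u)) => h1 h2.
  have := rnorm_distD (w k s u - w k t u) (((s - t)%:C)%C *: c) 0.
  rewrite !subr0 rnormZ rnorm_real; have := normr_ge0 (s - t); lra.
have gcont (u : Dom A) t e : K t -> 0 < e -> \forall s \near t, K s ->
    rnorm (fun_calc E U (g y t) (A u) - fun_calc E U (g y s) (A u)) < e.
  move=> Kt e0; have MA : 0 <= M * rnorm (A u) by rewrite mulr_ge0 ?rnorm_ge0// ltW.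
  have k0 : 0 < 8 * (M * rnorm (A u) + 1) by rewrite mulr_gt0// ltr_wpDl.
  have d0 : 0 < e / (8 * (M * rnorm (A u) + 1)) by rewrite divr_gt0.
  have [[V1 V2] /= [yV1 tV2] VP] := loc y t _ Kt d0.
  apply: filterS tV2 => s sV Ks; rewrite rnormBC.
  have ys : ess_le E U (g y s \- g y t) (e / (8 * (M * rnorm (A u) + 1))).
    by apply: (VP (y, s)) => //; split=> //; exact: nbhs_singleton yV1.
  have := fun_calc_distance sE M0 EM (A u) U_open (adg y s Ks) (adg y t Kt) d0 ys.
  move=> /le_lt_trans; apply.
  have {2}-> : e = 8 * (e / (8 * (M * rnorm (A u) + 1))) * (M * rnorm (A u) + 1).
    by field; rewrite gt_eqF// ltr_wpDl.
  by rewrite ltr_pM2l; [lra|exact: mulr_gt0].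
have Hcont (u : Dom A) t e : K t -> 0 < e -> \forall s \near t, K s ->
    rnorm (H t u - H s u) < e.
  move=> Kt e0; have e3 : 0 < e / 3 by lra.
  have [k _ /(_ k (leqnn k)) Hk] := Hunif u _ e3.
  apply: filterS (wcont k u t _ Kt e3) => s ws Ks.
  have := Hk t Kt; have := Hk s Ks; have := ws Ks.
  have := rnorm_distD (H t u) (w k t u) (H s u).
  by have := rnorm_distD (w k t u) (w k s u) (H s u); rewrite (rnormBC (w k s u)); lra.
have hderiv t : W t -> has_deriv (fun t => iF (H t)) t (iF (comp_op A (fun_calc E U (g y t)))).
  move=> Wt; rewrite /has_deriv.
  (* The difference quotient is formed in [F] before applying [iF], so that its limit can be tested
     on single vectors. *)
  pose Q s : linear_maps (Dom A) G :=
    ((s^-1)%:C)%C *: ((H (t + s) : linear_maps (Dom A) G) - (H t : linear_maps (Dom A) G)).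
  have -> : (fun s => ((s^-1)%:C)%C *: (iF (H (t + s)) - iF (H t))) = (fun s => iF (Q s)).
    by apply/funext => s; exact/esym/completion_quotient.
  apply: (completion_cvg Fhat_completion) => u e e0.
  have MA : 0 <= M * rnorm (A u) by rewrite mulr_ge0 ?rnorm_ge0// ltW.
  have k0 : 0 < 8 * (M * rnorm (A u) + 1) by rewrite mulr_gt0// ltr_wpDl.
  have d0 : 0 < e / (8 * (M * rnorm (A u) + 1)) by rewrite divr_gt0.
  have [del /= del0 delP] := (nbhs_ballP _ _).1
    (filterI (Hinc u t _ (WK t Wt) d0) (open_nbhs_nbhs (conj oW Wt))).
  near=> s.
  have s0 : s != 0 by near: s; exact: nbhs_dnbhs_neq.
  have sd : `|s| < del by near: s; exact: dnbhs0_lt.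
  have [|h Ws] := delP (t + s).
    by rewrite /ball/= opprD addrA subrr add0r normrN.
  have {h} := h (WK _ Ws); rewrite (addrAC t s (- t)) subrr add0r => h.
  pose c := fun_calc E U (g y t) (A u).
  suff : rnorm (c - ((s^-1)%:C)%C *: (H (t + s) u - H t u)) < e by [].
  have ns : 0 < `|s| by rewrite normr_gt0.
  (* Multiplied by [|s|], the claim becomes the increment estimate [Hinc] at [t + s]. *)
  rewrite rnormBC -(ltr_pM2l ns) -(rnorm_real s) -rnormZ scalerBr scalerA -rmorphM/=.
  rewrite divff// scale1r rnorm_real; apply: le_lt_trans h _.
  have {2}-> : e = 8 * (e / (8 * (M * rnorm (A u) + 1))) * (M * rnorm (A u) + 1).
    by field; rewrite gt_eqF// ltr_wpDl.
  have -> : 8 * (e / (8 * (M * rnorm (A u) + 1)) * `|s|) * (M * rnorm (A u)) =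
    `|s| * (8 * (e / (8 * (M * rnorm (A u) + 1))) * (M * rnorm (A u))) by ring.
  by rewrite ltr_pM2l// ltr_pM2l; [lra|exact: mulr_gt0].
exists (fun t => iF (H t)); split => //.
- exists (fun t => iF (comp_op A (fun_calc E U (g y t)))) => //.
  apply: (completion_continuous Fhat_completion) => t Wt u e e0.
  by apply: filterS (gcont u t e (WK t Wt) e0) => s h Ws; apply: h; exact: WK.
split.
- move=> k; apply: (completion_continuous Fhat_completion) => t Wt u e e0.
  apply: filterS (wcont k u t e (WK t Wt) e0) => s h Ws.
  by have := h (WK s Ws); rewrite !wE; exact.
- apply: (completion_continuous Fhat_completion) => t Wt u e e0.
  by apply: filterS (Hcont u t e (WK t Wt) e0) => s h Ws; apply: h; exact: WK.
apply: (completion_uniform Fhat_completion) => u e e0.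
by apply: filterS (Hunif u e e0) => k h t Wt; have := h t (WK t Wt); rewrite wE; exact.
Unshelve. all: by end_near.
Qed.
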